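(* Let $(W,S)$ be of type $B_{n+1}$, with $S=\{0,1,\dots,n\}$, let $i,j\in S$ with $(i,j)\neq(0,0)$, and let $y\in{}^i\mathcal H^j$. Then $$p_{e,y}=v^{\ell(y)}+v^{\ell(y)-2}+\cdots+v^{\ell(y)-2d},\qquad d=\min(n-i,n-j).$$
   Context: Type $B_{n+1}$, $n\geq1$: the simple reflections are labeled $0,1,\dots,n$ along the Coxeter diagram, which is a path $0-1-\cdots-n$ whose only multiple (double) edge joins $0$ and $1$. $\ell$ is the length function, $w_0$ the longest element, $e$ the identity. Penultimate cell: $\mathcal J=\{w_0u: u\in W\setminus\{e\}\text{ has a unique reduced expression}\}$ (a two-sided Kazhdan–Lusztig cell), and ${}^i\mathcal H^j$ is the set of $y\in\mathcal J$ whose unique left ascent is $i$ and unique right ascent is $j$ (i.e. left descent set $S\setminus\{i\}$ and right descent set $S\setminus\{j\}$). Explicitly: let $s_{ij}=i\cdots j$ be the product of simple reflections along the shortest path from $i$ to $j$ in the diagram; let $t_{ij}=i(i-1)\cdots101\cdots(j-1)j$ if $i\neq0$ or $j\neq0$ (so $t_{0j}=s_{0j}$, $t_{i0}=s_{i0}$) and $t_{00}=010$; put $w_{ij}=s_{ij}w_0$ and $u_{ij}=t_{ij}w_0$. Then ${}^i\mathcal H^j=\{u_{ij},w_{ij}\}$. Kazhdan–Lusztig polynomials: the Hecke algebra over $\mathbb Z[v,v^{-1}]$ is generated by $H_s$, $s\in S$, with the braid relations and $(H_s+v)(H_s-v^{-1})=0$; $H_w$ is the standard basis; the bar involution is the ring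 involution with $\overline v=v^{-1}$, $\overline{H_s}=H_s^{-1}$. The Kazhdan–Lusztig basis element $\underline H_w$ is the unique bar-invariant element of the form $\underline H_w=H_w+\sum_{y<w}p_{y,w}H_y$ with $p_{y,w}\in v\mathbb Z[v]$ (so $\underline H_s=H_s+v$); set $p_{w,w}=1$. *)

(* Defs.v *)
From HB Require Import structures.
From mathcomp Require Import all_boot all_order all_fingroup all_algebra.

Set Implicit Arguments.
Unset Strict Implicit.
Unset Printing Implicit Defensive.

Import GRing.Theory.

(* The diagram 0 - 1 - ... - n has n.+1 nodes; only the edge {0, 1} is double. *)
Definition typeB_matrix (n : nat) (i j : 'I_n.+1) : nat :=
  if i == j then 1
  else if (j == i.+1 :> nat) || (i == j.+1 :> nat) then
    if minn i j == 0 then 4 else 3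
  else 2.

Section Coxeter.

Variables (I : finType) (W : finGroupType) (s : I -> W).

Local Open Scope group_scope.

Definition word_prod (a : seq I) : W := \prod_(k <- a) s k.

(* W is the group presented by the generators s k and the relations
   (s k * s l) ^+ m k l = 1; m k k = 1 makes the generators involutions. *)
Record coxeter_system (m : I -> I -> nat) : Prop := CoxeterSystem {
  cox_gen : forall w : W, exists a : seq I, w = word_prod a;
  cox_rel : forall k l : I, (s k * s l) ^+ m k l = 1;
  cox_univ : forall (G : groupType) (g : I -> G),
    (forall k l : I, (g k * g l) ^+ m k l = 1) ->
    exists f : {multiplicative W -> G}, forall k : I, f (s k) = g k }.

(* Least size of a word representing w. The search stops at #|W|, which loses
   nothing: along a shortest word the prefix products are pairwise distinct. *)
Definition cox_length (w : W) : nat :=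
  find (fun k => [exists a : k.-tuple I, word_prod a == w]) (iota 0 #|W|).

Definition reduced (a : seq I) : bool := size a == cox_length (word_prod a).

Definition unique_reduced (w : W) : bool :=
  #|[set a : (cox_length w).-tuple I | word_prod a == w]| == 1%N.

Definition longest : W := [arg max_(w > 1) cox_length w].

Definition reflection (t : W) : bool := [exists k, exists x, t == s k ^ x].

Definition bruhat_step : rel W := fun x y =>
  [exists t, [&& reflection t, y == x * t & (cox_length x < cox_length y)%N]].

Definition bruhat_lt (x y : W) : bool := (x != y) && connect bruhat_step x y.

Definition left_descents (w : W) : {set I} :=
  [set k | (cox_length (s k * w) < cox_length w)%N].

Definition right_descents (w : W) : {set I} :=
  [set k | (cox_length (w * s k) < cox_length w)%N].

Definition penultimate_cell : {set W} :=
  [set longest * u | u : W & (u != 1) && unique_reduced u].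

Definition cell_block (i j : I) : {set W} :=
  [set y in penultimate_cell |
    (left_descents y == [set~ i]) && (right_descents y == [set~ j])].

End Coxeter.

Section Hecke.

Variables (I : finType) (m : I -> I -> nat).

Local Open Scope ring_scope.

(* alternating k a b = a * b * a * ... with k factors *)
Fixpoint alternating (A : nzRingType) (k : nat) (a b : A) : A :=
  if k is k'.+1 then a * alternating k' b a else 1.

(* A Z[v, v^-1]-algebra is encoded as a ring with a distinguished central
   unit, the image of v. *)
Record hecke_relations (A : unitRingType) (v : A) (H : I -> A) : Prop :=
  HeckeRelations {
    hecke_unit : v \is a GRing.unit;
    hecke_central : forall x : A, GRing.comm v x;
    hecke_quadratic : forall k : I, (H k + v) * (H k - v^-1) = 0;
    hecke_braid : forall k l : I, k != l ->
      alternating (m k l) (H k) (H l) = alternating (m k l) (H l) (H k) }.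

(* A is the Z[v, v^-1]-algebra presented by the generators H k and the Hecke
   relations: it is generated by them, and it maps to any other algebra
   satisfying the relations. *)
Record hecke_algebra (A : unitRingType) (v : A) (H : I -> A) : Prop :=
  HeckeAlgebra {
    hecke_rel : hecke_relations v H;
    hecke_gen : forall P : A -> Prop,
      P 1 -> P v -> P v^-1 -> (forall k : I, P (H k)) ->
      (forall x y : A, P x -> P y -> P (x - y)) ->
      (forall x y : A, P x -> P y -> P (x * y)) ->
      forall x : A, P x;
    hecke_univ : forall (B : unitRingType) (u : B) (b : I -> B),
      hecke_relations u b ->
      exists f : {rmorphism A -> B}, f v = u /\ forall k : I, f (H k) = b k }.

Variables (W : finGroupType) (s : I -> W) (A : unitRingType) (v : A).
Variable H : I -> A.

Definition standard_basis (T : W -> A) : Prop :=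
  forall a : seq I, reduced s a -> T (word_prod s a) = \prod_(k <- a) H k.

(* The quadratic relation makes each H k a unit, so the inverses are genuine. *)
Definition bar_involution (bar : {rmorphism A -> A}) : Prop :=
  [/\ involutive bar, bar v = v^-1 & forall k : I, bar (H k) = (H k)^-1].

Definition eval_v (q : {poly int}) : A := (map_poly intr q).[v].

Definition kl_element (T : W -> A) (p : W -> W -> {poly int}) (w : W) : A :=
  T w + \sum_(y : W | bruhat_lt s y w) eval_v (p y w) * T y.

(* p y w is the coefficient p_{y,w}; its values for y not below w in the Bruhat
   order are irrelevant. The condition (p y w)`_0 = 0 says p_{y,w} is in vZ[v]. *)
Definition kl_polynomials (T : W -> A) (bar : {rmorphism A -> A})
    (p : W -> W -> {poly int}) : Prop :=
  forall w : W,
    [/\ p w w = 1,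
        forall y : W, bruhat_lt s y w -> (p y w)`_0 = 0 &
        bar (kl_element T p w) = kl_element T p w].

End Hecke.

(* Main.v *)
Require Import Defs.
From mathcomp Require Import all_boot all_order all_fingroup all_algebra.
From mathcomp Require Import zify.

Set Implicit Arguments.
Unset Strict Implicit.
Unset Printing Implicit Defensive.

Import GRing.Theory.

(** Let m = n + 1.  The group W acts on the 2m positions 0, ..., 2m - 1 by
    permutations that commute with the mirror p |-> 2m - 1 - p; the boundary b
    separates the positions b - 1 and b, and s_k exchanges the two neighbours
    of the boundary m - k and those of its mirror image m + k.

    Geometrically x is the relative position of two flags V and V' of isotropic
    subspaces of a symplectic space of dimension 2m, and [overlap 0 r t x], the
    number of the first t positions that x sends into the first r, is the
    dimension of the intersection of V_r and V'_t, where V_r for r > m stands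
    for the orthogonal of V_(2m-r), and likewise for V'.  Let y = w0 z with z
    unique-reduced.  Unless the word of z is 010, it is a monotone walk from a
    boundary t up to a boundary d (only_word_walk), and with r = 2m - d the
    Schubert variety of y is the locus where V_r and V'_t meet.  Choosing a
    line in the intersection gives a resolution with fibre the projective
    space of dimension overlap - 1.  When it is small, which fails exactly
    for r = t = m, that is for i = j = 0, it predicts
      C_y = sum_x v^(l(y) - l(x)) (1 + v^-2 + ... + v^(-2(overlap x - 1))) T_x,
    and the coefficient at x = 1 is the asserted polynomial, because the
    identity has overlap min(r, t).

    The prediction is proved by checking the two properties that characterise
    the Kazhdan-Lusztig element.

    Bar invariance (bar_overlap).  Write Z_(r,t) for the sum above without the
    factor v^l(y).  Multiplication by H_s + v on the left, where s lives at
    the boundary r, sends Z_(r,t) to v Z_(r+1,t) + v^-1 Z_(r-1,t), and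
    multiplication on the right does the same to t (theta_pair, theta_left,
    theta_right).  As H_s + v is bar invariant, everything follows from
    Z_(1,1), the sum over the parabolic subgroup of type B_n.  That sum is
    reached from the trivial group by the same chain of multiplications, one
    rank at a time (bar_parabolic).

    Degrees (overlap_small).  All coefficients other than the one at y lie in
    v Z[v].  For w0 x this is a lower bound on its length in terms of the
    number of positions that it moves far to the right; it follows from
    functions that grow by at most 1 with each letter of a word
    (act_word_le, act_word_pair_le, crossing_count).

    Uniqueness (bar_fixed_eq0) needs the linear independence of the T_x, which
    is read off from the regular representation over Q(v) (left_hecke).

    What is used of W itself follows from the presentation: the action on
    positions is faithful (act_faithful, by enumeration of cosets), hence the
    length counts inversions (cox_length_inversions), and w0 is the mirror. *)

(** * Increasing maps and intervals of ordinals *)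

Lemma increasing_id N (f : nat -> nat) p :
  (forall b, 0 < b < N -> f b.-1 < f b) -> (forall q, q < N -> f q < N) ->
  p < N -> f p = p.
Proof.
move=> asc lt_f pN; have ge q : q < N -> q <= f q.
  by elim: q => // q IH qN; have /= := asc q.+1; have := IH (ltnW qN); lia.
have le d : d < N -> f (N.-1 - d) <= N.-1 - d.
  elim: d => [|d IH] dN; first by rewrite subn0; have := lt_f N.-1; lia.
  have := asc (N.-1 - d); have := IH (ltnW dN).
  have -> : (N.-1 - d).-1 = N.-1 - d.+1 by lia.
  by lia.
apply/eqP; rewrite eqn_leq ge // andbT.
by have := le (N.-1 - p); rewrite subKn; lia.
Qed.

Lemma card_ord_range N a b : #|[set q : 'I_N | a <= q < b]| = minn b N - a.
Proof.
rewrite -sum1_card big_mkcond /=.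
have -> : minn b N - a = \sum_(q < N) (a <= q < b : nat).
  by elim: N => [|N IH]; rewrite ?big_ord0 ?big_ord_recr /= -?IH; lia.
by apply: eq_bigr => q _; rewrite inE; case: ifP.
Qed.

(** * The permutation of the positions attached to a letter *)

Section Flips.

Variable m : nat.

(** For k = 0 the two boundaries m - k and m + k coincide.  Positions outside
    0, ..., 2m - 1 are fixed when k < m. *)
Definition flip (k p : nat) : nat :=
  if (p.+1 == m - k) || (p.+1 == m + k) then p.+1
  else if (p == m - k) || (p == m + k) then p.-1
  else p.

Variant flip_spec (k p : nat) : nat -> Prop :=
  | FlipUp of p.+1 = m - k \/ p.+1 = m + k : flip_spec k p p.+1
  | FlipDown q of p = q.+1 & p = m - k \/ p = m + k : flip_spec k p q
  | FlipFix of p <> m - k & p <> m + k & p.+1 <> m - k & p.+1 <> m + k :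
      flip_spec k p p.

Lemma flipP k p : k < m -> flip_spec k p (flip k p).
Proof.
rewrite /flip => km; case: ifP => [h|h]; first by constructor; lia.
case: ifP => h2; last by constructor; lia.
by constructor; lia.
Qed.

Lemma flipK k p : k < m -> flip k (flip k p) = p.
Proof. by move=> km; do 2 (case: flipP => //); lia. Qed.

Lemma flip_lt k p : k < m -> p < 2 * m -> flip k p < 2 * m.
Proof. by move=> km; case: flipP => //; lia. Qed.

Lemma flip_ge k p : k < m -> 2 * m <= p -> flip k p = p.
Proof. by move=> km; case: flipP => //; lia. Qed.

Lemma flip_mirror k p : k < m -> p < 2 * m ->
  flip k (2 * m - 1 - p) = 2 * m - 1 - flip k p.
Proof. by move=> km pm; do 2 (case: flipP => //); lia. Qed.

Lemma flip_up k p : p.+1 = m - k \/ p.+1 = m + k -> flip k p = p.+1.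
Proof. by rewrite /flip; case: ifP; lia. Qed.

Lemma flip_down k p : k < m -> p = m - k \/ p = m + k -> flip k p = p.-1.
Proof. by rewrite /flip => km h; rewrite ifF ?ifT; lia. Qed.

Lemma flip_fix k p :
  [&& p != m - k, p != m + k, p.+1 != m - k & p.+1 != m + k] -> flip k p = p.
Proof. by rewrite /flip => h; rewrite !ifF; lia. Qed.

(** A flip exchanges adjacent positions, so it reverses no comparison but that
    of two positions which it exchanges. *)
Lemma flip_ltE k a b : k < m -> a <> b ->
  (flip k b < flip k a) = (b < a) (+) (flip k a == b).
Proof.
move=> km ab; case: eqP => [e|].
  by move: ab; rewrite -e flipK //; case: flipP => //; lia.
case: (flipP a km) => [h|a' ea h|h1 h2 h3 h4];
  case: (flipP b km) => [h'|b' eb h'|h1' h2' h3' h4']; lia.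
Qed.

End Flips.

(** Evaluates nested flips from the inside out when the context decides which
    case of the definition applies. *)
Ltac eval_flip := repeat match goal with |- context [flip ?m ?k ?p] =>
  lazymatch p with context [flip _ _ _] => fail | _ => idtac end;
  first [rewrite (@flip_fix m k p); [|lia] | rewrite (@flip_up m k p); [|lia]
        | rewrite (@flip_down m k p); [|lia|lia]] end.

Section FlipRelations.

Variable m : nat.
Local Notation flip := (flip m).

Lemma flipC k l p : k < m -> l < m -> k.+1 < l ->
  flip k (flip l p) = flip l (flip k p).
Proof.
move=> km lm kl; have : [|| p == m - k, p.+1 == m - k, p == m + k, p.+1 == m + k,
  p == m - l, p.+1 == m - l, p == m + l, p.+1 == m + l |
  [&& p != m - k, p.+1 != m - k, p != m + k, p.+1 != m + k, p != m - l,
   p.+1 != m - l, p != m + l & p.+1 != m + l]] by lia.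
by do 8 (case/orP => [/eqP h|]; first by eval_flip; lia); move=> h; eval_flip.
Qed.

Lemma flip_braid3 k p : 0 < k -> k.+1 < m ->
  flip k (flip k.+1 (flip k p)) = flip k.+1 (flip k (flip k.+1 p)).
Proof.
move=> k0 km; have : [|| p.+2 == m - k, p.+1 == m - k, p == m - k, p.+1 == m + k,
  p == m + k, p == (m + k).+1 | [&& p.+2 != m - k, p.+1 != m - k, p != m - k,
  p.+1 != m + k, p != m + k & p != (m + k).+1]] by lia.
by do 6 (case/orP => [/eqP h|]; first by eval_flip; lia); move=> h; eval_flip.
Qed.

Lemma flip_braid4 p : 1 < m ->
  flip 0 (flip 1 (flip 0 (flip 1 p))) = flip 1 (flip 0 (flip 1 (flip 0 p))).
Proof.
move=> km; have : [|| p.+2 == m, p.+1 == m, p == m, p == m.+1 |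
  [&& p.+2 != m, p.+1 != m, p != m & p != m.+1]] by lia.
by do 4 (case/orP => [/eqP h|]; first by eval_flip; lia); move=> h; eval_flip.
Qed.

(** The index of the generator that acts across the boundary b: the distance
    of b from the centre. *)
Definition letter (b : nat) : nat := (m - b) + (b - m).

Lemma flip_across k d q : k < m -> 0 < d < 2 * m -> k <> letter d ->
  (d <= flip k q) = (d <= q).
Proof. by rewrite /letter => km dm; case: (flipP q km) => [|q' ->|] *; lia. Qed.

Lemma flip_across_le k d q : k < m -> d <= flip k q -> d <= q \/ q = d.-1.
Proof. by move=> km; case: (flipP q km) => [|q' ->|] *; lia. Qed.

(** The letters at the boundaries b, b - 1, ..., b - l + 1.  Acting with this
    word (rightmost letter first) carries the position b - l up to b. *)
Fixpoint walk (b l : nat) : seq nat :=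
  if l is l'.+1 then letter b :: walk b.-1 l' else [::].

Lemma walkS b l : walk b l.+1 = rcons (walk b l) (letter (b - l)).
Proof.
elim: l b => [|l IH] b; first by rewrite /= subn0.
by rewrite [LHS]/= -/(walk b.-1 l.+1) IH /=; congr (_ :: rcons _ (letter _)); lia.
Qed.

End FlipRelations.

(** * Relations between two involutions *)

Section Involutions.

Variables (G : finGroupType) (a b : G).
Hypotheses (aa : (a * a = 1)%g) (bb : (b * b = 1)%g).

Lemma involution_commP : (a * b = b * a)%g <-> ((a * b) ^+ 2 = 1)%g.
Proof.
rewrite expgS expg1; split=> [e|e]; first by rewrite {1}e mulgA -(mulgA b) aa mulg1.
have := congr1 (fun z => (z * (b * a))%g) e.
by rewrite /= mul1g => <-; rewrite -!mulgA (mulgA b b) bb mul1g aa mulg1.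
Qed.

Lemma involution_braid3P : (a * b * a = b * a * b)%g <-> ((a * b) ^+ 3 = 1)%g.
Proof.
rewrite !expgS expg0 mulg1; split=> [e|e].
  by rewrite !mulgA e -!mulgA (mulgA b b) bb mul1g (mulgA a a) aa mul1g.
have := congr1 (fun z => (z * (b * a * b))%g) e.
rewrite /= mul1g => <-; rewrite -!mulgA (mulgA b b) bb mul1g (mulgA a a) aa mul1g.
by rewrite bb mulg1.
Qed.

Lemma involution_braid4P :
  (a * b * a * b = b * a * b * a)%g <-> ((a * b) ^+ 4 = 1)%g.
Proof.
rewrite !expgS expg0 mulg1; split=> [e|e].
  rewrite !mulgA e -!mulgA (mulgA a a) aa mul1g (mulgA b b) bb mul1g.
  by rewrite (mulgA a a) aa mul1g.
have := congr1 (fun z => (z * (b * a * b * a))%g) e.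
rewrite /= mul1g => <-; rewrite -!mulgA (mulgA b b) bb mul1g (mulgA a a) aa mul1g.
by rewrite (mulgA b b) bb mul1g aa mulg1.
Qed.

End Involutions.

(** * The action on positions *)

Section Action.

Variables (n : nat) (W : finGroupType) (s : 'I_n.+1 -> W).
Hypothesis hW : coxeter_system s (@typeB_matrix n).
Local Notation m := n.+1.

Definition flip_ord (k : 'I_m) (p : 'I_(2 * m)) : 'I_(2 * m) :=
  Ordinal (flip_lt (ltn_ord k) (ltn_ord p)).

Lemma flip_ordK k : involutive (flip_ord k).
Proof. by move=> p; apply: val_inj; rewrite /= flipK. Qed.

Definition flip_perm (k : 'I_m) : {perm 'I_(2 * m)} := perm (inv_inj (@flip_ordK k)).

Lemma flip_perm_rel (k l : 'I_m) :
  ((flip_perm k * flip_perm l) ^+ typeB_matrix k l = 1)%g.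
Proof.
have inv k' : (flip_perm k' * flip_perm k' = 1)%g.
  by apply/permP => p; rewrite permM !permE flip_ordK.
rewrite /typeB_matrix; case: eqP => [<-|kl]; first by rewrite expg1 inv.
have braid3 (k1 k2 : 'I_m) : 0 < k1 -> k2 = k1.+1 :> nat ->
    (flip_perm k1 * flip_perm k2 * flip_perm k1 =
     flip_perm k2 * flip_perm k1 * flip_perm k2)%g.
  move=> k0 e; apply/permP => p; apply: val_inj.
  by rewrite !permM !permE /= e flip_braid3 // -e ltn_ord.
have braid4 (k1 k2 : 'I_m) : k1 = 0 :> nat -> k2 = 1 :> nat ->
    (flip_perm k1 * flip_perm k2 * flip_perm k1 * flip_perm k2 =
     flip_perm k2 * flip_perm k1 * flip_perm k2 * flip_perm k1)%g.
  move=> e0 e1; apply/permP => p; apply: val_inj.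
  by rewrite !permM !permE /= e0 e1 flip_braid4 // -e1 ltn_ord.
case: ifP => adj; last first.
  apply/(involution_commP (inv k) (inv l))/permP => p; apply: val_inj.
  rewrite !permM !permE /=.
  have [h|h] : k.+1 < l \/ l.+1 < k.
    have : nat_of_ord k != nat_of_ord l by apply/eqP => /ord_inj.
    by lia.
  - by rewrite [RHS]flipC ?ltn_ord.
  - by rewrite [LHS]flipC ?ltn_ord.
case: ifP => [/eqP mn|mn].
  apply/(involution_braid4P (inv k) (inv l)).
  have [[e1 e2]|[e1 e2]] : (k = 0 :> nat /\ l = 1 :> nat) \/ (l = 0 :> nat /\ k = 1 :> nat).
    by lia.
  - by rewrite braid4.
  - by rewrite -braid4.
apply/(involution_braid3P (inv k) (inv l)).
case/orP: adj => /eqP e.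
- by rewrite braid3 //; lia.
- by rewrite -braid3 //; lia.
Qed.

(** Permutations compose from left to right, so the inverse turns the morphism
    into a left action. *)
Lemma action_exists : exists act : W -> nat -> nat,
  [/\ forall p, act 1%g p = p,
      forall x y p, act (x * y)%g p = act x (act y p) &
      forall k p, act (s k) p = flip m k p].
Proof.
have [f fE] := cox_univ hW flip_perm_rel.
pose act x p := if insub p is Some i then val (f x^-1%g i) else p.
have f1 : f 1%g = 1%g.
  by apply: (mulgI (f 1%g)); rewrite mulg1 -[in RHS](mulg1 1%g) gmulfM.
have actE x (i : 'I_(2 * m)) : act x i = val (f x^-1%g i).
  by rewrite /act insubT // => h; congr (val (f _ _)); apply: val_inj.
have act_ge x p : 2 * m <= p -> act x p = p.
  by move=> h; rewrite /act insubF //; lia.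
exists act; split=> [p|x y p|k p].
- by have [h|h] := ltnP p (2 * m); [rewrite (actE _ (Ordinal h)) invg1 f1 perm1|rewrite act_ge].
- have [h|h] := ltnP p (2 * m); last by rewrite !act_ge.
  by rewrite !(actE _ (Ordinal h)) actE invMg gmulfM permM.
- have [h|h] := ltnP p (2 * m); last by rewrite act_ge ?flip_ge.
  rewrite (actE _ (Ordinal h)).
  have -> : (s k)^-1%g = s k.
    apply/eqP; rewrite eq_invg_mul.
    by have := cox_rel hW k k; rewrite /typeB_matrix eqxx expg1 => ->.
  by rewrite fE permE.
Qed.

End Action.

(** * Evaluation at v in a field of fractions *)

Section Evaluation.

Local Open Scope ring_scope.

Lemma eval_v_rmorph (R S : unitRingType) (g : {rmorphism R -> S}) x q :
  g (eval_v x q) = eval_v (g x) q.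
Proof.
rewrite /eval_v -horner_map -map_poly_comp; congr (_.[_]).
by apply: eq_map_poly => z /=; rewrite rmorph_int.
Qed.

Local Notation F := {fraction {poly int}}.
Local Notation X := (tofrac ('X : {poly int})).

Lemma v_frac_neq0 : X != 0.
Proof. by rewrite tofrac_eq0 polyX_eq0. Qed.

Lemma eval_X q : eval_v X q = tofrac q.
Proof.
have {2}-> : q = (map_poly (intr : int -> {poly int}) q).['X].
  rewrite -[LHS]comp_polyXr /comp_poly; congr (_.[_]).
  by apply: eq_map_poly => z; rewrite -[LHS]/((z%:P : {poly int})) -[in LHS](intz z) rmorph_int.
rewrite /eval_v -(horner_map (@tofrac _)) -map_poly_comp; congr (_.[_]).
by apply: eq_map_poly => z /=; rewrite rmorph_int.
Qed.

(** With d the degree of q > 0, the hypothesis says that v^d q(v) equals the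
    reversed polynomial, whose degree is at most d < 2d. *)
Lemma bar_fixed_poly_eq0 (q : {poly int}) : q`_0 = 0 -> eval_v X q = eval_v X^-1 q -> q = 0.
Proof.
move=> q0 e; apply/eqP; apply: contraT => qn0.
have sq : (1 < size q)%N.
  rewrite ltnNge; apply/negP => /size1_polyC qC; move: qn0.
  by rewrite qC q0 eqxx.
set d := (size q).-1; have dE : size q = d.+1 by rewrite /d prednK // ltnW.
have : 'X^d * q = \sum_(i < d.+1) q`_i *: 'X^(d - i).
  apply/eqP; rewrite -tofrac_eq rmorphM /= -(eval_X q) e; apply/eqP.
  rewrite /eval_v (horner_coef_wide _ (size_poly _ _)) dE.
  rewrite mulr_sumr rmorph_sum; apply: eq_bigr => i _.
  rewrite coef_poly ltn_ord -mul_polyC rmorphM /= rmorphXn /= tofracXn.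
  rewrite mulrCA; congr (_ * _).
    by rewrite -[in RHS](intz q`_i) !rmorph_int.
  by rewrite exprVn -exprB ?unitfE ?v_frac_neq0 // -ltnS.
move/(congr1 (fun r : {poly int} => r`_(d + d))); rewrite /= coefXnM ltnNge leq_addr /= addnK.
rewrite coef_sum big1 => [|i _].
  by move/eqP; rewrite /d -lead_coefE lead_coef_eq0 (negbTE qn0).
by rewrite coefZ coefXn (_ : _ == _ = false) ?mulr0 //; move: sq dE; lia.
Qed.

End Evaluation.

(** * The generators of W and the faithfulness of the action *)

Section TypeB.

Variables (n : nat) (W : finGroupType) (s : 'I_n.+1 -> W).
Hypothesis hW : coxeter_system s (@typeB_matrix n).
Local Notation m := n.+1.
Local Open Scope group_scope.

Lemma word_cons k a : word_prod s (k :: a) = s k * word_prod s a.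
Proof. exact: big_cons. Qed.

Lemma word_cat a b : word_prod s (a ++ b) = word_prod s a * word_prod s b.
Proof. exact: big_cat. Qed.

Lemma gen2 k : s k * s k = 1.
Proof. by have := cox_rel hW k k; rewrite /typeB_matrix eqxx expg1. Qed.

Lemma genV k : (s k)^-1 = s k.
Proof. by apply/eqP; rewrite eq_invg_mul gen2. Qed.

Lemma genK k x : s k * (s k * x) = x.
Proof. by rewrite mulgA gen2 mul1g. Qed.

Lemma genKr k x : x * s k * s k = x.
Proof. by rewrite -mulgA gen2 mulg1. Qed.

Lemma gen_comm (k l : 'I_m) : k.+1 < l -> s k * s l = s l * s k.
Proof.
move=> kl; apply/(involution_commP (gen2 k) (gen2 l)).
have := cox_rel hW k l; rewrite /typeB_matrix.
by rewrite ifF ?ifF //; [lia|apply/eqP => e; move: kl; rewrite e; lia].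
Qed.

Lemma gen_braid3 (k l : 'I_m) : 0 < k -> l = k.+1 :> nat ->
  s k * s l * s k = s l * s k * s l.
Proof.
move=> k0 e; apply/(involution_braid3P (gen2 k) (gen2 l)).
have := cox_rel hW k l; rewrite /typeB_matrix e eqxx ifF ?ifF //=.
- by lia.
- by apply/eqP => e'; move: e; rewrite e'; lia.
Qed.

Lemma gen_braid4 (k l : 'I_m) : k = 0 :> nat -> l = 1%N :> nat ->
  s k * s l * s k * s l = s l * s k * s l * s k.
Proof.
move=> e0 e1; apply/(involution_braid4P (gen2 k) (gen2 l)).
have := cox_rel hW k l; rewrite /typeB_matrix e1 e0 /= ifF //.
by apply/eqP => e'; move: e1; rewrite -e' e0.
Qed.

(** Natural numbers as letters, so that arithmetic on letters stays free of
    bound proofs; the value is meaningful for k < m only. *)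
Definition natgen (k : nat) : W := s (inord k).

Lemma natgen_comm k l : k < m -> l < m -> k.+1 < l \/ l.+1 < k ->
  natgen k * natgen l = natgen l * natgen k.
Proof.
move=> km lm [h|h]; first by rewrite /natgen gen_comm ?inordK.
by rewrite /natgen [RHS]gen_comm ?inordK.
Qed.

Lemma natgen_braid3 k l : 0 < k -> 0 < l -> k < m -> l < m ->
  k = l.+1 \/ l = k.+1 ->
  natgen k * (natgen l * natgen k) = natgen l * (natgen k * natgen l).
Proof.
move=> k0 l0 km lm [] e; rewrite !mulgA /natgen; last by rewrite gen_braid3 ?inordK.
by rewrite [RHS]gen_braid3 ?inordK.
Qed.

Lemma natgen_braid4 : 0 < n ->
  natgen 0 * (natgen 1 * (natgen 0 * natgen 1)) =
  natgen 1 * (natgen 0 * (natgen 1 * natgen 0)).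
Proof. by move=> n0; rewrite !mulgA /natgen gen_braid4 ?inordK. Qed.

(** The letters k-1, ..., 1, 0, 1, ..., k-1 that carry the first of the 2k central
    positions step by step to the last. *)
Definition coset_letter (k j : nat) : nat := (k.-1 - j) + (j - k.-1).

(** Representatives of the 2k left cosets of the subgroup generated by the letters
    below k - 1 in the one generated by the letters below k. *)
Fixpoint coset_rep (k j : nat) : W :=
  if j is j'.+1 then natgen (coset_letter k j') * coset_rep k j' else 1.

(** A letter that neither prolongs nor shortens the walk passes through the
    representative and becomes a letter below k - 1.  If l commutes with the leftmost
    letter c, it passes it; otherwise the representative starts with c l, and a braid
    relation turns l c l into c l c, or 0 1 0 1 into 1 0 1 0 when the walk has just
    turned at 0. *)
Lemma coset_rep_comm k j l : k <= m -> j < 2 * k -> l < k ->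
  l <> coset_letter k j -> (forall i, j = i.+1 -> l <> coset_letter k i) ->
  exists2 l', l' < k.-1 & natgen l * coset_rep k j = coset_rep k j * natgen l'.
Proof.
move=> km; elim/ltn_ind: j l => -[|j] IH l jk lk lj lj'.
  by exists l; rewrite /= ?mulg1 ?mul1g //; move: lj; rewrite /coset_letter; lia.
have {}lj' := lj' j erefl; rewrite /=.
have tm : coset_letter k j < m by rewrite /coset_letter; lia.
have [far|near] : (l.+1 < coset_letter k j \/ (coset_letter k j).+1 < l) \/
   ((coset_letter k j) = l.+1 \/ l = (coset_letter k j).+1) by lia.
  have [] := IH j _ l _ _ lj'; try lia.
    by move=> i e; move: far lj; rewrite e /coset_letter; lia.
  move=> l' l'k e; exists l' => //.
  by rewrite mulgA natgen_comm -?mulgA ?e //; lia.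
case: j near tm lj lj' IH jk => [|j] near tm lj lj' IH jk.
  by move: near lj; rewrite /coset_letter; lia.
have lE : l = coset_letter k j by move: near lj lj'; rewrite /coset_letter; lia.
rewrite /= -lE; set c := coset_letter k j.+1 in near tm *.
have [jt|jt] := eqVneq j.+1 k; last first.
  have [] := IH j _ c; try by rewrite /c /coset_letter; lia.
  move=> l' l'k e; exists l' => //.
  rewrite -!mulgA -e !mulgA; congr (_ * _).
  have := @natgen_braid3 l c; rewrite !mulgA => -> //;
    by move: lj jt near; rewrite lE /c /coset_letter; lia.
have l0 : l = 0 by rewrite lE -jt /coset_letter; lia.
have c1 : c = 1%N by rewrite /c -jt /coset_letter; lia.
have [i ji] : exists i, j = i.+1 by exists j.-1; lia.
have t1 : coset_letter k i = 1%N by rewrite -jt ji /coset_letter; lia.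
have [] := IH i _ 0%N; try by rewrite /coset_letter; lia.
move=> l' l'k e; exists l' => //; rewrite ji /=.
rewrite l0 c1 t1 -!mulgA -e !mulgA; congr (_ * _).
by have := natgen_braid4; rewrite !mulgA => -> //; lia.
Qed.

Lemma word_ind (P : W -> Prop) :
  P 1 -> (forall k x, P x -> P (s k * x)) -> forall x, P x.
Proof.
move=> P1 PS x; have [a ->] := cox_gen hW x.
by elim: a => [|k a IH]; [rewrite /word_prod big_nil|rewrite word_cons; apply: PS].
Qed.

Variable act : W -> nat -> nat.
Hypotheses (act1 : forall p, act 1 p = p)
  (actM : forall x y p, act (x * y) p = act x (act y p))
  (act_gen : forall k p, act (s k) p = flip m k p).

Lemma actK x p : act x^-1 (act x p) = p.
Proof. by rewrite -actM mulVg act1. Qed.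

Lemma actKV x p : act x (act x^-1 p) = p.
Proof. by rewrite -actM mulgV act1. Qed.

Lemma act_inj x p q : act x p = act x q -> p = q.
Proof. by move=> e; rewrite -(actK x p) e actK. Qed.

Lemma act_lt x p : p < 2 * m -> act x p < 2 * m.
Proof.
move=> pm; move: x; apply: word_ind => [|k x IH]; first by rewrite act1.
by rewrite actM act_gen flip_lt.
Qed.

Lemma act_mirror x p : p < 2 * m -> act x (2 * m - 1 - p) = 2 * m - 1 - act x p.
Proof.
move=> pm; move: x; apply: word_ind => [|k x IH]; first by rewrite !act1.
by rewrite !actM !act_gen IH flip_mirror // act_lt.
Qed.

Definition gen_below (k : nat) (x : W) : Prop :=
  exists2 a : seq 'I_m, all (fun l : 'I_m => l < k) a & x = word_prod s a.

Lemma gen_below_mul k l x : l < k -> k <= m -> gen_below k x ->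
  gen_below k (natgen l * x).
Proof.
move=> lk km [a ak ->]; exists (inord l :: a); last by rewrite word_cons.
by rewrite /= inordK ?lk //; lia.
Qed.

Lemma gen_below_fix k x p : k <= m -> gen_below k x -> p < m - k -> act x p = p.
Proof.
move=> km [a ak ->] pk; elim: a ak => [|l a IH] /=; first by rewrite /word_prod big_nil act1.
by case/andP=> lk /IH e; rewrite word_cons actM e act_gen flip_fix //; lia.
Qed.

Lemma act_coset_rep k j : 0 < k <= m -> j < 2 * k ->
  act (coset_rep k j) (m - k) = m - k + j.
Proof.
move=> km; elim: j => [|j IH] jk /=; first by rewrite act1 addn0.
rewrite actM IH ?act_gen; last by lia.
rewrite inordK; last by rewrite /coset_letter; lia.
by rewrite flip_up /coset_letter; lia.
Qed.

(** The representatives times the smaller subgroup are stable under left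
    multiplication by every letter below k: the letter lengthens the walk,
    shortens it, or passes through by coset_rep_comm. *)
Lemma gen_below_coset k x : 0 < k <= m -> gen_below k x ->
  exists j y, [/\ j < 2 * k, gen_below k.-1 y & x = coset_rep k j * y].
Proof.
move=> km [a ak ->]; elim: a ak => [|l a IH] /=.
  move=> _; exists 0%N, 1; split; first by lia.
    by exists [::] => //; rewrite /word_prod big_nil.
  by rewrite /word_prod big_nil mulg1.
case/andP=> lk /IH [j [y [jk yk ey]]].
have sl : s l = natgen l by rewrite /natgen inord_val.
rewrite word_cons ey sl; have [e|ne] := eqVneq (l : nat) (coset_letter k j).
  exists j.+1, y; split=> //; last by rewrite /= e mulgA.
  by move: e; rewrite /coset_letter; lia.
have [/existsP[i /andP[/eqP ji /eqP e]]|none] :=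
    boolP [exists i : 'I_(2 * k), (j == i.+1) && (l == coset_letter k i :> nat)].
  exists i, y; split=> //.
  by rewrite ji /= -e -sl !mulgA gen2 mul1g.
have [] := @coset_rep_comm k j l; try by [lia|apply/eqP].
  move=> i ji e; case/negP: none; apply/existsP.
  have ik : i < 2 * k by lia.
  by exists (Ordinal ik); rewrite /= ji e !eqxx.
move=> l' l'k e; exists j, (natgen l' * y); split=> //.
  by apply: gen_below_mul => //; lia.
by rewrite mulgA e mulgA.
Qed.

(** If x lies in the coset of the j-th representative, it moves the first of the
    2k central positions by j; hence j = 0 and x lies in the smaller subgroup. *)
Lemma act_faithful x : (forall p, p < 2 * m -> act x p = p) -> x = 1.
Proof.
move=> xfix; have ind k : k <= m -> gen_below k x -> x = 1.
  elim: k => [|k IH] km; first by case=> -[|l a] //= _ ->; rewrite /word_prod big_nil.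
  case/gen_below_coset=> [|j [y [jk yk e]]]; first by lia.
  suff j0 : j = 0%N by apply: IH; [lia|rewrite e j0 mul1g].
  by have := xfix (m - k.+1); rewrite e actM (gen_below_fix _ yk) ?act_coset_rep //; lia.
apply: (ind m) => //; have [a ->] := cox_gen hW x.
by exists a => //; apply/allP => l _; apply: ltn_ord.
Qed.

Lemma act_ext x y : (forall p, p < 2 * m -> act x p = act y p) -> x = y.
Proof.
move=> xy; apply/(mulgI y^-1); rewrite mulVg; apply: act_faithful => p pm.
by rewrite actM xy // actK.
Qed.

(** * Length as number of inversions *)

(** The pairs p < q with p + q < 2m represent the positive roots: of the two
    mirror images (p, q) and (2m-1-q, 2m-1-p) one is kept. *)
Definition inversions (x : W) : {set 'I_(2 * m) * 'I_(2 * m)} :=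
  [set pq : 'I_(2 * m) * 'I_(2 * m) |
    [&& pq.1 < pq.2, pq.1 + pq.2 < 2 * m & act x pq.2 < act x pq.1]].

(** The order of the two positions that x sends next to the boundary m - k; it will
    tell whether s_k x is longer than x. *)
Definition up (k : 'I_m) (x : W) : bool := act x^-1 (m - k).-1 < act x^-1 (m - k).

Lemma act_eq x p c : (act x p == c) = (p == act x^-1 c).
Proof. by apply/eqP/eqP => [<-|->]; rewrite ?actK ?actKV. Qed.

(** With P < Q the positions that x sends next to the boundary m - k, the only
    comparison that changes is that of P and Q, or rather of their mirror images if
    P + Q is too large. *)
Lemma inversions_up k x : up k x ->
  #|inversions (s k * x)| = #|inversions x|.+1.
Proof.
rewrite /up => lt_PQ; have km := ltn_ord k.
have Plt : act x^-1 (m - k).-1 < 2 * m by apply: act_lt; lia.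
have Qlt : act x^-1 (m - k) < 2 * m by apply: act_lt; lia.
have eP : act x^-1 (m + k) = 2 * m - 1 - act x^-1 (m - k).-1.
  by rewrite -act_mirror; [congr (act _ _)|]; lia.
have eQ : act x^-1 (m + k).-1 = 2 * m - 1 - act x^-1 (m - k).
  by rewrite -act_mirror; [congr (act _ _)|]; lia.
have hit (c : nat) (p : 'I_(2 * m)) := act_eq x p c.
move: (hit (m - k).-1) (hit (m - k)) (hit (m + k)) (hit (m + k).-1).
rewrite eP eQ; move: (act x^-1 (m - k)) (act x^-1 (m - k).-1) lt_PQ Plt Qlt {eP eQ} => Q P.
move=> lt_PQ Plt Qlt hP hQ hP' hQ'.
have [p0 [q0 [p0E q0E]]] : exists p0 q0 : 'I_(2 * m),
    p0 = (if P + Q < 2 * m then P else 2 * m - 1 - Q) :> nat /\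
    q0 = (if P + Q < 2 * m then Q else 2 * m - 1 - P) :> nat.
  have [PQ|PQ] := ltnP (P + Q) (2 * m); first by exists (Ordinal Plt), (Ordinal Qlt).
  have h1 : 2 * m - 1 - Q < 2 * m by lia.
  have h2 : 2 * m - 1 - P < 2 * m by lia.
  by exists (Ordinal h1), (Ordinal h2).
have val0 : ((act x p0 == (m - k).-1) && (act x q0 == m - k)) ||
            ((act x p0 == (m + k).-1) && (act x q0 == m + k)).
  rewrite hP hQ hQ' hP' p0E q0E {hP hQ hP' hQ' hit}.
  by case: ifP => _; rewrite !eqxx ?orbT.
have sw0 : ~~ (act x q0 < act x p0) by move: val0; lia.
have sw (p q : 'I_(2 * m)) : p < q -> p + q < 2 * m ->
    (flip m k (act x p) == act x q) = (p == p0) && (q == q0).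
  move=> pq pqm; apply/idP/idP; last first.
    case/andP=> /eqP -> /eqP ->; case/orP: val0 => /andP[/eqP -> /eqP ->].
      by rewrite flip_up; lia.
    by rewrite flip_up; lia.
  have ne : act x p <> act x q by move/act_inj => e; move: pq; rewrite e ltnn.
  rewrite -!val_eqE /= p0E q0E.
  move: (hP p) (hQ p) (hP' p) (hQ' p) (hP q) (hQ q) (hP' q) (hQ' q) ne.
  move: (act x p) (act x q) => a b hp1 hp2 hp3 hp4 hq1 hq2 hq3 hq4 ne.
  case: (flipP a km) => [[h|h]|a' ea [h|h]|? ? ? ?] /eqP ab.
  - have pE : p = P :> nat by apply/eqP; rewrite -hp1; apply/eqP; clear -h; lia.
    have qE : q = Q :> nat by apply/eqP; rewrite -hq2; apply/eqP; clear -h ab; lia.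
    by move: pq pqm; rewrite pE qE; case: ifP; clear -lt_PQ Plt Qlt; lia.
  - have pE : p = (2 * m - 1 - Q) :> nat by apply/eqP; rewrite -hp4; apply/eqP; clear -h; lia.
    have qE : q = (2 * m - 1 - P) :> nat by apply/eqP; rewrite -hq3; apply/eqP; clear -h ab; lia.
    by move: pq pqm; rewrite pE qE; case: ifP; clear -lt_PQ Plt Qlt; lia.
  - have pE : p = Q :> nat by apply/eqP; rewrite -hp2; apply/eqP; clear -h ea; lia.
    have qE : q = P :> nat by apply/eqP; rewrite -hq1; apply/eqP; clear -h ab ea; lia.
    by move: pq pqm; rewrite pE qE; case: ifP; clear -lt_PQ Plt Qlt; lia.
  - have pE : p = (2 * m - 1 - P) :> nat by apply/eqP; rewrite -hp3; apply/eqP; clear -h ea; lia.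
    have qE : q = (2 * m - 1 - Q) :> nat by apply/eqP; rewrite -hq4; apply/eqP; clear -h ab ea; lia.
    by move: pq pqm; rewrite pE qE; case: ifP; clear -lt_PQ Plt Qlt; lia.
  - by case: ne.
have pq0 : (p0 < q0) && (p0 + q0 < 2 * m) by rewrite p0E q0E; case: ifP; lia.
have -> : inversions (s k * x) = (p0, q0) |: inversions x.
  apply/setP => -[p q]; rewrite !inE /= xpair_eqE !actM !act_gen !andbA.
  have [/andP[pq pqm]|out] := boolP ((p < q) && (p + q < 2 * m)); last first.
    rewrite andFb orbF; apply/esym/negbTE; apply: contra out.
    by case/andP=> /eqP -> /eqP ->.
  have ne : act x p <> act x q by move/act_inj => e; move: pq; rewrite e ltnn.
  rewrite !andTb flip_ltE // -sw //; case: eqP => [e|]; last by rewrite addbF.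
  have := sw p q pq pqm; rewrite e eqxx => /esym/andP[/eqP pE /eqP qE].
  by rewrite pE qE (negbTE sw0).
rewrite cardsU1 inE /= (negbTE sw0) !andbF //.
Qed.

Lemma act_genV k x p : act (s k * x)^-1 p = act x^-1 (flip m k p).
Proof. by rewrite invMg genV actM act_gen. Qed.

Lemma up_gen k x : up k (s k * x) = ~~ up k x.
Proof.
have km := ltn_ord k; rewrite /up !act_genV flip_up ?flip_down //; try lia.
have -> : (m - k).-1.+1 = m - k by lia.
by rewrite -leqNgt [RHS]leq_eqVlt; case: eqP => // e; have := act_inj e; lia.
Qed.

Lemma inversions_down k x : ~~ up k x -> #|inversions x| = #|inversions (s k * x)|.+1.
Proof. by move=> dn; have := @inversions_up k (s k * x); rewrite up_gen genK => ->. Qed.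

Lemma inversions1 : #|inversions 1| = 0.
Proof. by apply: eq_card0 => -[p q]; rewrite !inE /= !act1; lia. Qed.

Lemma inversions_word a : #|inversions (word_prod s a)| <= size a.
Proof.
elim: a => [|k a IH] /=; first by rewrite /word_prod big_nil inversions1.
rewrite word_cons; have [/inversions_up->|/inversions_down e] := boolP (up k (word_prod s a)).
  by rewrite ltnS.
by move: IH; rewrite e => /leqW/ltnW.
Qed.

Lemma up_boundary (k : 'I_m) b x : 0 < b < 2 * m -> k = letter m b :> nat ->
  up k x = (act x^-1 b.-1 < act x^-1 b).
Proof.
rewrite /letter => bm kE; have [h|h] := leqP b m.
  by rewrite /up (_ : m - k = b) //; lia.
have e1 : (m - k).-1 = 2 * m - 1 - b by clear -bm kE h; lia.
have e2 : m - k = 2 * m - 1 - b.-1 by clear -bm kE h; lia.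
have h1 : b < 2 * m by clear -bm; lia.
have h2 : b.-1 < 2 * m by clear -bm; lia.
rewrite /up e1 e2 !act_mirror //.
have := act_lt x^-1 h1; have := act_lt x^-1 h2; clear; lia.
Qed.

Lemma letter_lt b : 0 < b < 2 * m -> letter m b < m.
Proof. by rewrite /letter; lia. Qed.

(** The inverse of x is then increasing on all positions, hence the identity. *)
Lemma sorted_eq1 x : (forall k, up k x) -> x = 1.
Proof.
move=> upx; suff /(congr1 invg) : x^-1 = 1 by rewrite invgK invg1.
apply: act_faithful => p; apply: increasing_id => [b bm|q]; last exact: act_lt.
by rewrite -(@up_boundary (Ordinal (letter_lt bm))).
Qed.

Lemma short_word x : exists2 a : seq 'I_m, size a = #|inversions x| & x = word_prod s a.
Proof.
have [i] := ubnP #|inversions x|; elim: i x => // i IH x xi.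
have [/forallP/sorted_eq1 ->|/forallPn[k dn]] := boolP [forall k, up k x].
  by exists [::]; rewrite /word_prod ?big_nil ?inversions1.
have e := inversions_down dn; case: (IH (s k * x)); first by lia.
by move=> a sa ea; exists (k :: a); rewrite /= ?sa -?e // word_cons -ea genK.
Qed.

(** Removing inversions one at a time yields elements with every smaller number of
    inversions.  The bound makes the search in the definition of the length succeed. *)
Lemma inversions_lt x : #|inversions x| < #|W|.
Proof.
suff [f fi] : exists f : 'I_#|inversions x|.+1 -> W, injective f.
  by have := leq_card f fi; rewrite card_ord.
suff : forall i, i <= #|inversions x| -> exists y, #|inversions y| == i.
  move=> ex; have {}ex (i : 'I_#|inversions x|.+1) : exists y, #|inversions y| == i.
    by apply: ex; rewrite -ltnS ltn_ord.
  exists (fun i => xchoose (ex i)) => i j e.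
  by have := xchooseP (ex i); rewrite e (eqP (xchooseP (ex j))) => /eqP/ord_inj.
have [d] := ubnP #|inversions x|; elim: d x => // d IH x xd i.
rewrite leq_eqVlt => /orP[/eqP ->|ix]; first by exists x.
have [/forallP/sorted_eq1 e|/forallPn[k dn]] := boolP [forall k, up k x].
  by move: ix; rewrite e inversions1.
have e := inversions_down dn.
by apply: (IH (s k * x)); lia.
Qed.

Lemma cox_length_inversions x : cox_length s x = #|inversions x|.
Proof.
set P := fun k => [exists a : k.-tuple 'I_m, word_prod s a == x].
have Pinv : P #|inversions x|.
  have [a sa ea] := short_word x; apply/existsP.
  by exists (tcast sa (in_tuple a)); rewrite val_tcast /= -ea.
rewrite /cox_length -/P; set k := find _ _.
have some_size : has P (iota 0 #|W|).
  by apply/hasP; exists #|inversions x| => //; rewrite mem_iota inversions_lt.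
have klt : k < #|W| by move: some_size; rewrite has_find size_iota.
apply/eqP; rewrite eqn_leq; apply/andP; split; last first.
  have := nth_find 0 some_size; rewrite -/k nth_iota // add0n.
  case/existsP=> a /eqP <-; rewrite -[leqRHS](size_tuple a).
  exact: inversions_word.
rewrite leqNgt; apply/negP => /(before_find 0).
by rewrite nth_iota ?inversions_lt // add0n Pinv.
Qed.

Local Notation ell := (cox_length s).

Lemma ell_up k x : up k x -> ell (s k * x) = (ell x).+1.
Proof. by rewrite !cox_length_inversions; apply: inversions_up. Qed.

Lemma ell_down k x : ~~ up k x -> ell x = (ell (s k * x)).+1.
Proof. by rewrite !cox_length_inversions; apply: inversions_down. Qed.

Lemma upE k x : up k x = (ell x < ell (s k * x)).
Proof. by have [/ell_up ->|/ell_down ->] := boolP (up k x); lia. Qed.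

Lemma ell1 : ell 1 = 0.
Proof. by rewrite cox_length_inversions inversions1. Qed.

Lemma ell_word a : ell (word_prod s a) <= size a.
Proof. by rewrite cox_length_inversions inversions_word. Qed.

Lemma reduced_word x : exists2 a : seq 'I_m, size a = ell x & x = word_prod s a.
Proof. by rewrite cox_length_inversions; apply: short_word. Qed.

Lemma word_rev a : word_prod s (rev a) = (word_prod s a)^-1.
Proof.
elim: a => [|k a IH]; first by rewrite /word_prod big_nil invg1.
by rewrite rev_cons -cats1 word_cat !word_cons IH invMg genV /word_prod big_nil mulg1.
Qed.

Lemma ellV x : ell x^-1 = ell x.
Proof.
suff le y : ell y^-1 <= ell y by apply/eqP; rewrite eqn_leq le -{1}(invgK x) le.
by have [a <- ->] := reduced_word y; rewrite -word_rev -(size_rev a) ell_word.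
Qed.

(** * The longest element *)

Local Notation w0 := (longest s).

Lemma longest_down k : ~~ up k w0.
Proof.
rewrite /longest; case: arg_maxnP => //= w _ max.
by apply/negP => /ell_up e; have := max (s k * w) isT; rewrite e ltnn.
Qed.

(** Every generator shortens w0, so its inverse is decreasing on positions. *)
Lemma act_longest p : p < 2 * m -> act w0 p = 2 * m - 1 - p.
Proof.
have rev q : q < 2 * m -> 2 * m - 1 - act w0^-1 q = q.
  apply: (@increasing_id (2 * m) (fun q => 2 * m - 1 - act w0^-1 q)) => [b bm|r rm].
    have := longest_down (Ordinal (letter_lt bm)); rewrite (up_boundary _ bm) // -leqNgt.
    have : act w0^-1 b.-1 <> act w0^-1 b by move/act_inj; lia.
    have h : b.-1 < 2 * m by lia.
    by have := act_lt w0^-1 h; lia.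
  by lia.
move=> pm; have h : 2 * m - 1 - p < 2 * m by lia.
have := rev _ h; have := act_lt w0^-1 h => l e.
by rewrite -[RHS](actKV w0) (_ : act w0^-1 _ = p) //; lia.
Qed.

Lemma longest_comm x : w0 * x = x * w0.
Proof.
by apply: act_ext => p pm; rewrite !actM !act_longest ?act_mirror ?act_lt.
Qed.

Lemma longest2 : w0 * w0 = 1.
Proof. by apply: act_faithful => p pm; rewrite actM !act_longest; lia. Qed.

Lemma longestK x : w0 * (w0 * x) = x.
Proof. by rewrite mulgA longest2 mul1g. Qed.

Lemma longestV x : (w0 * x)^-1 = w0 * x^-1.
Proof. by rewrite invMg longest_comm (eqP (_ : w0^-1 == w0)) // eq_invg_mul longest2. Qed.

Lemma up_longest k x : up k (w0 * x) = ~~ up k x.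
Proof.
have km := ltn_ord k; rewrite /up longestV !actM !act_longest; try (apply: act_lt; lia).
have := act_eq x^-1 (m - k) (act x^-1 (m - k).-1).
have h1 : (m - k).-1 < 2 * m by lia.
have h2 : m - k < 2 * m by lia.
have := act_lt x^-1 h1; have := act_lt x^-1 h2.
by rewrite actK; case: eqP; lia.
Qed.

(** The p-th row has 2m - 1 - 2p entries for p < m and none otherwise. *)
Lemma card_roots :
  #|[set pq : 'I_(2 * m) * 'I_(2 * m) | (pq.1 < pq.2) && (pq.1 + pq.2 < 2 * m)]| = (m ^ 2)%N.
Proof.
pose Q (p q : 'I_(2 * m)) := (p < q) && (p + q < 2 * m).
rewrite -sum1_card (eq_bigl (fun pq => Q pq.1 pq.2)); last by move=> pq; rewrite inE.
rewrite -(pair_big_dep xpredT Q (fun _ _ => 1%N)) /=.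
rewrite (eq_bigr (fun p : 'I_(2 * m) => (2 * m - p - p.+1)%N)); last first.
  move=> p _; rewrite sum1_card -[RHS](_ : minn (2 * m - p) (2 * m) - p.+1 = _)%N; last by lia.
  rewrite -card_ord_range; apply: eq_card => q; rewrite !inE /Q.
  by have := ltn_ord p; lia.
have sum i : \sum_(p < i) ((2 * m - p - p.+1)%N) = (minn i m * (2 * m - minn i m))%N.
  by elim: i => [|i IH]; rewrite ?big_ord0 ?big_ord_recr /= ?IH; nia.
by rewrite sum; nia.
Qed.

Lemma ell_longest x : (ell (w0 * x) + ell x = m ^ 2)%N.
Proof.
rewrite !cox_length_inversions -card_roots -cardsUI.
have -> : inversions (w0 * x) :&: inversions x = set0.
  apply/setP => -[p q]; rewrite !inE /= !actM !act_longest ?act_lt //.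
  by have := act_lt x (ltn_ord p); have := act_lt x (ltn_ord q); lia.
rewrite cards0 addn0; apply: eq_card => -[p q]; rewrite !inE /= !actM !act_longest ?act_lt //.
have := act_lt x (ltn_ord p); have := act_lt x (ltn_ord q).
have : p < q -> act x p <> act x q by move=> pq /act_inj; lia.
by lia.
Qed.

(** * Unique reduced words *)

Definition only_word (a : seq 'I_m) : Prop :=
  forall b, size b = size a -> word_prod s b = word_prod s a -> b = a.

Lemma only_word_behead k a : only_word (k :: a) -> only_word a.
Proof.
move=> u b sb eb; suff [] : k :: b = k :: a by [].
by apply: u; rewrite /= ?sb // !word_cons eb.
Qed.

(** Letters that commute could be exchanged, and a repeated letter could be replaced
    by another one, as there are at least two. *)
Lemma only_word_adjacent k l a : 0 < n -> only_word [:: k, l & a] ->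
  k = l.+1 :> nat \/ l = k.+1 :> nat.
Proof.
move=> n0 u; have [kl|lk|kl] := ltngtP k l.
- right; have [//|far] := eqVneq (l : nat) k.+1.
  suff [e _] : [:: l, k & a] = [:: k, l & a] by move: kl; rewrite e ltnn.
  by apply: u => //; rewrite !word_cons !mulgA (@gen_comm k l) //; lia.
- left; have [//|far] := eqVneq (k : nat) l.+1.
  suff [e _] : [:: l, k & a] = [:: k, l & a] by move: lk; rewrite e ltnn.
  by apply: u => //; rewrite !word_cons !mulgA (@gen_comm l k) //; lia.
- pose k' : 'I_m := if k == ord0 then ord_max else ord0.
  suff [e _] : [:: k', k' & a] = [:: k, l & a].
    exfalso; move: e; rewrite /k'; case: eqP => [->|ne] e; last by case: ne.
    by have /= n0' := congr1 val e; move: n0; rewrite n0'.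
  by apply: u => //; rewrite !word_cons !genK (ord_inj kl) genK.
Qed.

Lemma only_word_braid3 (k l : 'I_m) a : 0 < k -> 0 < l -> k = l.+1 :> nat \/ l = k.+1 :> nat ->
  ~ only_word [:: k, l, k & a].
Proof.
move=> k0 l0 kl u; suff [e _] : [:: l, k, l & a] = [:: k, l, k & a] by case: kl; rewrite e; lia.
apply: u => //; rewrite !word_cons !mulgA; congr (_ * _).
by case: kl => e; rewrite ?(gen_braid3 _ e) // -(gen_braid3 _ e).
Qed.

Lemma only_word_braid4 (k l : 'I_m) a : k + l = 1%N ->
  ~ only_word [:: k, l, k, l & a].
Proof.
move=> kl u; suff [e _] : [:: l, k, l, k & a] = [:: k, l, k, l & a].
  by move: kl; rewrite e; lia.
apply: u => //; rewrite !word_cons !mulgA; congr (_ * _).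
have [[e0 e1]|[e0 e1]] : (k = 0 :> nat /\ l = 1%N :> nat) \/ (l = 0 :> nat /\ k = 1%N :> nat) by lia.
- by rewrite (gen_braid4 e0 e1).
- by rewrite (gen_braid4 e0 e1).
Qed.

(** Prefixing a walk by a letter either prolongs it or reverses its direction.  A
    reversal k l k admits a braid move unless 0 and 1 are involved; the reversal
    1 0 1 is a walk across the centre, and 0 1 0 cannot be prolonged without
    creating 0101 or 1010. *)
Lemma only_word_walk a : 0 < n -> 0 < size a -> only_word a ->
  map val a = [:: 0; 1; 0]%N \/
  exists2 b, size a <= b < 2 * m & map val a = walk m b (size a).
Proof.
move=> n0; elim: a => // k a IH _ u; have ua := only_word_behead u.
case: a IH u ua => [|l a] IH u ua.
  right; exists (m + k)%N; first by have := ltn_ord k; rewrite /=; lia.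
  by rewrite /= /letter; congr [:: _]; lia.
have adj := only_word_adjacent n0 u; have km := ltn_ord k; have lm := ltn_ord l.
have [e|[b]] := IH isT ua.
  case: a e u {IH ua} => [|k' [|l' [|? ?]]] //= [l0 k1 l'0] u.
  have e : k' = k by apply: ord_inj; lia.
  have e' : l' = l by apply: ord_inj; lia.
  by case: (@only_word_braid4 k l [::]); [lia|move: u; rewrite e e'].
move=> /= sb [lE aE].
have [kE|kE] := eqVneq (k : nat) (letter m b.+1).
  right; exists b.+1; last by rewrite /= kE lE aE.
  by move: kE sb; rewrite /letter; lia.
have kne := kE; have {}kE : k = letter m b.-1 :> nat by move: kE lE adj; rewrite /letter; lia.
case: a IH u ua sb aE => [|k' a] IH u ua sb aE.
  (* a walk of one letter can also be read at the mirror boundary *)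
  right; exists (2 * m - b).+1; first by move: sb kE; rewrite /letter /=; lia.
  rewrite /= kE lE /letter; congr [:: _; _]; lia.
move: aE => /= [k'E aE]; have e : k' = k by apply: ord_inj; lia.
rewrite {}e in u k'E *.
have [k0|k0] := posnP k; last first.
  case: (@only_word_braid3 k l a) => //; move: adj k0 kE kne lE; rewrite /letter; lia.
have l1 : l = 1%N :> nat by lia.
left; case: a u aE sb {IH ua} => [|l' a] u aE sb /=; first by rewrite k0 l1.
move: aE => /= [l'E _]; have e : l' = l.
  apply: ord_inj; rewrite l'E l1; move: kE k0 sb lE l1; rewrite /letter /=; lia.
by case: (@only_word_braid4 k l a); [lia|move: u; rewrite e].
Qed.

(** * Lower bounds for the length *)

Lemma act_word_le (a : seq 'I_m) p : act (word_prod s a) p <= p + size a.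
Proof.
elim: a => [|k a IH]; first by rewrite /word_prod big_nil act1 addn0.
rewrite word_cons actM act_gen /= addnS.
have km := ltn_ord k; case: (flipP (act (word_prod s a) p) km) => [h|q qE h|*]; lia.
Qed.

Lemma act_word_max (a : seq 'I_m) p :
  act (word_prod s a) p = (p + size a)%N -> map val a = walk m (p + size a) (size a).
Proof.
elim: a => //= k a IH; rewrite word_cons actM act_gen addnS => e.
have le := act_word_le a p; move: e; case: flipP => //; try lia.
move=> h [e]; rewrite -IH //; congr (_ :: _); rewrite /letter; lia.
Qed.

(** A letter can raise two positions at once only when they leave m - k - 1 and
    m + k - 1 together, that is when their sum passes from 2m - 2 to 2m.  This
    happens once on balance, which the boolean records. *)
Lemma act_word_pair_le (a : seq 'I_m) p q :
  p < 2 * m -> q < 2 * m -> p <> q -> p + q <> (2 * m - 1)%N ->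
  act (word_prod s a) p + act (word_prod s a) q <=
  p + q + size a + (2 * m <= act (word_prod s a) p + act (word_prod s a) q).
Proof.
move=> pm qm pq pq'; elim: a => [|k a]; first by rewrite /word_prod big_nil !act1; lia.
rewrite word_cons !actM !act_gen /=; set z := word_prod s a.
have ne : act z p <> act z q by move/act_inj.
have ne' : act z p + act z q <> (2 * m - 1)%N.
  move=> e; suff : q = (2 * m - 1 - p)%N by lia.
  by apply: (@act_inj z); rewrite act_mirror //; lia.
have km := ltn_ord k; move: (act z p) (act z q) ne ne' => u v ne ne'.
case: (flipP u km) => [h|u' ue h|h1 h2 h3 h4];
  case: (flipP v km) => [h'|v' ve h'|h1' h2' h3' h4']; lia.
Qed.

(** The positions below t which z carries to d or beyond. *)
Definition crossing (d t : nat) (z : W) : {set 'I_(2 * m)} :=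
  [set p : 'I_(2 * m) | (p < t) && (d <= act z p)].

(** Only the letter at the boundary d can make a position cross d. *)
Lemma crossing_count d t (a : seq 'I_m) : 0 < d < 2 * m ->
  #|crossing d t (word_prod s a)| <=
  (t - d) + count (fun k : 'I_m => k == letter m d :> nat) a.
Proof.
move=> dm; elim: a => [|k a IH] /=.
  rewrite addn0; apply: leq_trans (_ : #|[set p : 'I_(2 * m) | d <= p < t]| <= _).
    apply/subset_leq_card/subsetP => p.
    by rewrite !inE /word_prod big_nil act1 andbC.
  by rewrite card_ord_range; lia.
rewrite word_cons; case: eqP => [kd|kd]; last first.
  rewrite add0n; apply: leq_trans IH; apply/subset_leq_card/subsetP => p.
  by rewrite !inE actM act_gen flip_across.
have h : act (word_prod s a)^-1 d.-1 < 2 * m by apply: act_lt; lia.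
apply: (@leq_trans #|Ordinal h |: crossing d t (word_prod s a)|); last first.
  by rewrite cardsU1 addnCA leq_add //; case: (_ \notin _).
apply/subset_leq_card/subsetP => p; rewrite !inE actM act_gen -val_eqE /=.
case/andP=> -> /flip_across_le [//|->|e]; first by rewrite orbT.
by rewrite -e actK eqxx.
Qed.

(** One position climbing from below t to d needs d - t + 1 letters; with no letter
    to spare each letter must be the one at the next boundary. *)
Lemma crossing_walk d t z : t <= d -> 0 < #|crossing d t z| ->
  d - t < ell z /\ (ell z = (d - t).+1 ->
  exists2 a : seq 'I_m, z = word_prod s a & map val a = walk m d (d - t).+1).
Proof.
move=> td P0; have [p pt dz] : exists2 p : nat, p < t & d <= act z p.
  by case/card_gt0P: P0 => p; rewrite inE => /andP[pt dz]; exists p.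
have [a sa za] := reduced_word z; rewrite -sa.
have := act_word_le a p; rewrite -za => le; split; first by lia.
move=> e; exists a => //; have pd : (p + size a)%N = d by lia.
by rewrite -e -{1}pd; apply: act_word_max; rewrite -za; lia.
Qed.

Lemma crossing_card_le d t e z : e <= 2 * m ->
  (forall p, p \in crossing d t z -> act z p < e) -> #|crossing d t z| <= e - d.
Proof.
move=> em lt_e; pose f (p : 'I_(2 * m)) := Ordinal (act_lt z (ltn_ord p)).
have f_inj : injective f by move=> p q /(congr1 val)/act_inj/ord_inj.
rewrite -(card_imset _ f_inj); apply: leq_trans (_ : #|[set q : 'I_(2 * m) | d <= q < e]| <= _).
  apply/subset_leq_card/subsetP => q /imsetP[p pP ->]; rewrite inE /= lt_e // andbT.
  by move: pP; rewrite inE => /andP[].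
by rewrite card_ord_range (minn_idPl em).
Qed.

(** For t < d two of the crossing positions, chosen with small source and large
    target, already force the bound by act_word_pair_le.  For t = d that bound is
    off by one; instead the letters at the three distinct boundaries d - 1, d, d + 1
    occur together at least 3 * #|P| - 2 times, and these letters are distinct
    because d is not the centre. *)
Lemma crossing_small d t z : t <= d < 2 * m -> (t, d) <> (m, m) ->
  1 < #|crossing d t z| -> d - t + 2 * #|crossing d t z| <= ell z.
Proof.
set P := crossing d t z => td tdm P2.
have [a sa za] := reduced_word z; rewrite -sa.
have inP p : p \in P -> p < t /\ d <= act z p by rewrite inE => /andP.
have [p0 p0P] : exists p, p \in P by apply/card_gt0P; lia.
have [g0|g0] := eqVneq t d.
  have t_m : d <> m by move=> e; apply: tdm; rewrite g0 e.
  have tge : #|P| <= t.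
    apply: leq_trans (_ : #|[set p : 'I_(2 * m) | 0 <= p < t]| <= _).
      by apply/subset_leq_card/subsetP => p /inP; rewrite inE; lia.
    by rewrite card_ord_range; lia.
  have c0 : #|P| <= count (fun k : 'I_m => k == letter m d :> nat) a.
    by have := @crossing_count d t a; rewrite -za (_ : t - d = 0)%N; [apply; lia|lia].
  have c1 : #|P|.-1 <= count (fun k : 'I_m => k == letter m d.+1 :> nat) a.
    have d1 : d.+1 < 2 * m.
      have := @crossing_card_le d t (2 * m) z (leqnn _) (fun p _ => act_lt z (ltn_ord p)).
      by rewrite -/P; lia.
    have h : act z^-1 d < 2 * m by apply: act_lt; lia.
    have le1 : #|P| <= #|Ordinal h |: crossing d.+1 t z|.
      apply/subset_leq_card/subsetP => p; rewrite !inE -val_eqE /= => /andP[->] /=.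
      by rewrite leq_eqVlt eq_sym act_eq.
    apply: (@leq_trans #|crossing d.+1 t z|).
      move: le1; rewrite cardsU1; case: (_ \notin _); first by case: #|P|.
      exact: leq_trans (leq_pred _).
    by have := @crossing_count d.+1 t a d1; rewrite -za (_ : t - d.+1 = 0)%N //; lia.
  have c2 : #|P|.-1 <= count (fun k : 'I_m => k == letter m d.-1 :> nat) a.
    have d1 : 0 < d.-1 < 2 * m by lia.
    have le1 : #|P| <= #|crossing d.-1 t z|.
      by apply/subset_leq_card/subsetP => p; rewrite !inE; lia.
    have := @crossing_count d.-1 t a d1; rewrite -za (_ : t - d.-1 = 1)%N; last by lia.
    by move/(leq_trans le1); case: #|P|.
  have : count (fun k : 'I_m => k == letter m d :> nat) a +
    (count (fun k : 'I_m => k == letter m d.+1 :> nat) a +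
     count (fun k : 'I_m => k == letter m d.-1 :> nat) a) <= size a.
    elim: (a) => //= k b; rewrite /letter; lia.
  lia.
case: (arg_minnP (fun p : 'I_(2 * m) => p) p0P) => p1 p1P p1min.
case: (arg_maxnP (fun p : 'I_(2 * m) => act z p) p0P) => p2 p2P p2max.
have {}p1P : p1 \in P by [].
have {}p2P : p2 \in P by [].
have min_p : #|P| <= t - p1.
  apply: leq_trans (_ : #|[set p : 'I_(2 * m) | p1 <= p < t]| <= _).
    apply/subset_leq_card/subsetP => p pP; rewrite inE p1min //.
    by case: (inP _ pP).
  by rewrite card_ord_range; lia.
have max_p : #|P| <= (act z p2).+1 - d.
  apply: crossing_card_le => [|p pP]; first by rewrite act_lt.
  by rewrite ltnS; apply: p2max.
(* if the lowest source also has the highest target, any other position will do *)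
have [p pP [pp1 pd]] : exists2 p, p \in P & p != p1 /\
    2 * d + #|P| <= act z p1 + act z p + 1.
  have [p2p1|p2p1] := eqVneq p2 p1; last first.
    by exists p2 => //; split=> //; have := inP _ p1P; lia.
  have /card_gt0P[p] : 0 < #|P :\ p1|.
    by move: P2; rewrite (cardsD1 p1) p1P add1n ltnS.
  rewrite !inE => /andP[pp1 pP]; exists p; first by rewrite inE.
  by split=> //; have := inP p; rewrite inE pP -p2p1 => /(_ isT); lia.
have [pt dp] := inP _ pP; have [p1t dp1] := inP _ p1P.
have ne : p1 <> p :> nat by move=> /ord_inj e; move: pp1; rewrite e eqxx.
have mir : p1 + p <> (2 * m - 1)%N.
  move=> e; have pE : p = (2 * m - 1 - p1)%N :> nat by lia.
  by move: dp; rewrite pE act_mirror //; lia.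
have := act_word_pair_le a (ltn_ord p1) (ltn_ord p) ne mir; rewrite -za.
by case: (2 * m <= _); lia.
Qed.

(** * The overlap statistic *)

(** The case c > 0 serves the parabolic subgroup that fixes the first c positions. *)
Definition overlap (c r t : nat) (x : W) : nat :=
  \sum_(c <= q < r) (act x^-1 q < t).

Lemma overlap_card r t x : r <= 2 * m ->
  overlap 0 r t x = #|[set q : 'I_(2 * m) | (q < r) && (act x^-1 q < t)]|.
Proof.
move=> rm; rewrite /overlap -sum1_card (big_nat_widen _ _ (2 * m)) // big_mkord.
rewrite [RHS](eq_bigl (fun q : 'I_(2 * m) => (q < r) && (act x^-1 q < t))); last by move=> q; rewrite inE.
by rewrite [RHS]big_mkcondr; apply: eq_bigr => q _; case: ifP.
Qed.

Lemma card_act_preim x (P : pred nat) :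
  #|[set p : 'I_(2 * m) | P p]| = #|[set q : 'I_(2 * m) | P (act x q)]|.
Proof.
pose f (q : 'I_(2 * m)) := Ordinal (act_lt x (ltn_ord q)).
have f_inj : injective f by move=> p q /(congr1 val)/act_inj/ord_inj.
rewrite -[RHS](card_imset _ f_inj); apply: eq_card => p; rewrite inE; apply/idP/imsetP => [Pp|[q]].
  exists (Ordinal (act_lt x^-1 (ltn_ord p))); last by apply: ord_inj; rewrite /= actKV.
  by rewrite inE /= actKV.
by rewrite inE => Pq ->.
Qed.

Lemma overlapV r t x : r <= 2 * m -> t <= 2 * m -> overlap 0 r t x = overlap 0 t r x^-1.
Proof.
move=> rm tm; rewrite !overlap_card // invgK.
have /= -> := card_act_preim x (fun q => (q < r) && (act x^-1 q < t)).
by apply: eq_card => q; rewrite !inE actK andbC.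
Qed.

(** The longest element mirrors the positions, so sending a position into the first
    r becomes sending it to 2m - r or beyond. *)
Lemma overlap_crossing r t x : r <= 2 * m ->
  overlap 0 r t x = #|crossing (2 * m - r) t (w0 * x)|.
Proof.
move=> rm; rewrite overlap_card //.
have /= -> := card_act_preim x (fun q => (q < r) && (act x^-1 q < t)).
apply: eq_card => q; rewrite !inE actK actM act_longest ?act_lt // andbC; congr (_ && _).
by have := act_lt x (ltn_ord q); lia.
Qed.

Lemma act_walk (a : seq 'I_m) p :
  map val a = walk m (p + size a) (size a) -> act (word_prod s a) p = (p + size a)%N.
Proof.
elim: a => [|k a IH]; first by rewrite /word_prod big_nil act1 addn0.
rewrite /= addnS => -[kE aE]; rewrite word_cons actM act_gen IH // flip_up //.
by have := ltn_ord k; move: kE; rewrite /letter; lia.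
Qed.

Section Smallness.

Variables (a : seq 'I_m) (d t : nat).
Hypotheses (t0 : 0 < t) (td : t <= d < 2 * m) (tdm : (t, d) <> (m, m)).
Hypotheses (a_walk : map val a = walk m d (d - t).+1) (a_red : reduced s a).
Let y := w0 * word_prod s a.

Let size_a : size a = (d - t).+1.
Proof.
have size_walk b l : size (walk m b l) = l by elim: l b => //= l IH b; rewrite IH.
by rewrite -(size_map val a) a_walk size_walk.
Qed.

Let ell_y : (ell y + (d - t).+1 = m ^ 2)%N.
Proof. by rewrite -size_a (eqP a_red) ell_longest. Qed.

Lemma overlap_top : overlap 0 (2 * m - d) t y = 1%N.
Proof.
rewrite overlap_crossing ?leq_subr // /y longestK subKn; last by lia.
have pos : 0 < #|crossing d t (word_prod s a)|.
  have h : t.-1 < 2 * m by lia.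
  apply/card_gt0P; exists (Ordinal h); rewrite inE /=.
  have dE : (t.-1 + size a)%N = d by rewrite size_a; lia.
  by rewrite act_walk dE ?size_a //; lia.
apply/eqP; rewrite eqn_leq pos andbT leqNgt; apply/negP => /(crossing_small td tdm).
by rewrite -(eqP a_red) size_a; lia.
Qed.

(** The smallness of the resolution: the coefficient at x of the expected element
    has lowest exponent l(y) - l(x) - 2 (overlap - 1), and this is positive. *)
Lemma overlap_small x : x <> y -> 0 < overlap 0 (2 * m - d) t x ->
  ell x + 2 * overlap 0 (2 * m - d) t x <= (ell y).+1.
Proof.
have dm : d <= 2 * m by lia.
rewrite overlap_crossing ?leq_subr // subKn // => ne pos.
have td' : t <= d by lia.
have [gt eq] := crossing_walk td' pos; have lx := ell_longest x.
have [k2|k2] := ltnP 1 #|crossing d t (w0 * x)|.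
  by have := crossing_small td tdm k2; lia.
have -> : #|crossing d t (w0 * x)| = 1%N by apply/eqP; rewrite eqn_leq k2.
suff : ell (w0 * x) <> (d - t).+1 by lia.
move=> /eq[b xb bw]; case: ne; rewrite -[LHS]longestK xb /y.
by congr (_ * word_prod s _); apply: (inj_map val_inj); rewrite a_walk.
Qed.

End Smallness.

(** The statement strengthened for the induction covers the ranges that end at one
    of the two boundaries, where the last position is exchanged for the next one. *)
Lemma sum_flip (F : nat -> nat) (k : 'I_m) c r : c < m - k -> c <= r ->
  r <> (m - k)%N -> r <> (m + k)%N ->
  \sum_(c <= q < r) F (flip m k q) = \sum_(c <= q < r) F q.
Proof.
have km := ltn_ord k => ck cr r1 r2.
pose e r := (r == (m - k)%N) || (r == (m + k)%N).
suff main : (\sum_(c <= q < r) F (flip m k q) + e r * F r.-1 =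
             \sum_(c <= q < r) F q + e r * F r)%N.
  by move: main; rewrite (_ : e r = false) ?addn0 // /e; lia.
elim: {r1 r2} r cr => [|r IH] cr.
  by rewrite !big_geq // /e (_ : _ || _ = false) //; lia.
have [cr'|rc] := leqP c r; last first.
  by rewrite !big_geq // /e (_ : _ || _ = false) //; lia.
rewrite !big_nat_recr //=; have := IH cr'.
move: (\sum_(c <= q < r) _) (\sum_(c <= q < r) _) => S1 S2.
case: (flipP r km) => [h|r' rE h|h1 h2 h3 h4].
- have -> : e r = false by rewrite /e; clear -h km; lia.
  have -> : e r.+1 = true by rewrite /e; clear -h km; lia.
  by clear; lia.
- rewrite rE; have -> : e r'.+1 = true by rewrite /e; clear -h rE km; lia.
  have -> : e r'.+2 = false by rewrite /e; clear -h rE km; lia.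
  by rewrite /=; clear; lia.
- have -> : e r = false by rewrite /e; clear -h1 h2; lia.
  have -> : e r.+1 = false by rewrite /e; clear -h3 h4; lia.
  by clear; lia.
Qed.

Lemma overlap_gen (k : 'I_m) c r t x : c < m - k -> c <= r ->
  r <> (m - k)%N -> r <> (m + k)%N -> overlap c r t (s k * x) = overlap c r t x.
Proof.
move=> ck cr r1 r2; rewrite /overlap -(sum_flip (fun q => act x^-1 q < t) ck cr r1 r2).
by apply: eq_bigr => q _; rewrite act_genV.
Qed.

(** * Ascents under left and right multiplication *)

Lemma ell_ind (P : W -> Prop) :
  P 1 -> (forall k x, up k x -> P x -> P (s k * x)) -> forall x, P x.
Proof.
move=> P1 PS x; have [d] := ubnP (ell x); elim: d x => // d IH x xd.
have [/forallP all_up|/forallPn[k dn]] := boolP [forall k, up k x].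
  by rewrite (sorted_eq1 all_up).
have h := PS k (s k * x); rewrite genK up_gen in h.
have lt : ell (s k * x) < d by have := ell_down dn; lia.
exact (h dn (IH _ lt)).
Qed.

(** The comparison that defines an ascent changes only if s_l exchanges the two
    positions which x sends next to the boundary m - k, and then x conjugates s_l
    to s_k. *)
Lemma up_mulr (k l : 'I_m) x : s k * x <> x * s l -> up k (x * s l) = up k x.
Proof.
have km := ltn_ord k; have lm := ltn_ord l.
move=> ne; rewrite /up invMg genV !actM !act_gen.
set P := act x^-1 (m - k).-1; set Q := act x^-1 (m - k).
have PQ : Q <> P by move/act_inj; lia.
rewrite flip_ltE //; case: eqP => [e|]; last by rewrite addbF.
case: ne; apply: act_ext => p pm; rewrite !actM !act_gen.
have xP : act x P = (m - k).-1 by rewrite actKV.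
have xQ : act x Q = (m - k)%N by rewrite actKV.
have Pm : P < 2 * m by apply: act_lt; lia.
have Qm : Q < 2 * m by apply: act_lt; lia.
have e' : flip m l P = Q by rewrite -e flipK.
have xP' : act x (2 * m - 1 - P) = (m + k)%N by rewrite act_mirror ?xP //; lia.
have xQ' : act x (2 * m - 1 - Q) = (m + k).-1 by rewrite act_mirror ?xQ //; lia.
have fP' : flip m l (2 * m - 1 - P) = (2 * m - 1 - Q)%N by rewrite flip_mirror ?e'.
have fQ' : flip m l (2 * m - 1 - Q) = (2 * m - 1 - P)%N by rewrite flip_mirror ?e.
have [->|pP] := eqVneq p P; first by rewrite e' xP xQ flip_up; clear -km; lia.
have [->|pQ] := eqVneq p Q; first by rewrite e xP xQ flip_down; clear -km; lia.
have [->|pP'] := eqVneq p (2 * m - 1 - P)%N; first by rewrite fP' xP' xQ' flip_down; clear -km; lia.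
have [->|pQ'] := eqVneq p (2 * m - 1 - Q)%N; first by rewrite fQ' xP' xQ' flip_up; clear -km; lia.
have -> : flip m l p = p.
  clear xP xQ xP' xQ' fP' fQ' e; move: e' pP pQ pP' pQ' PQ; rewrite -/P -/Q.
  move: P Q Pm Qm => P Q Pm Qm e' pP pQ pP' pQ' PQ.
  clear -lm Pm Qm pm e' pP pQ pP' pQ' PQ.
  case: (flipP p lm) => [h|q pq h|//]; move: e';
    by case: (flipP P lm) => [h'|q' pq' h'|h1 h2 h3 h4] e'; lia.
have away c q : act x q = c -> p <> q -> act x p <> c by move=> <- ne /act_inj.
rewrite flip_fix //; apply/and4P; split; apply/eqP.
- exact: away xQ (elimN eqP pQ).
- exact: away xP' (elimN eqP pP').
- by have h := away _ _ xP (elimN eqP pP); clear -h km; lia.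
- by have h := away _ _ xQ' (elimN eqP pQ'); clear -h km; lia.
Qed.

Lemma up1 k : up k 1.
Proof. by have km := ltn_ord k; rewrite /up invg1 !act1; lia. Qed.

Lemma up_gen1 (k l : 'I_m) : k != l -> up k (s l).
Proof.
move=> kl; have km := ltn_ord k; have lm := ltn_ord l.
have {}kl : k <> l :> nat by move/ord_inj/eqP; apply/negP.
rewrite /up genV !act_gen; case: (flipP (m - k).-1 lm) => [h|q qE h|h1 h2 h3 h4];
  case: (flipP (m - k) lm) => [h'|q' qE' h'|h1' h2' h3' h4']; lia.
Qed.

Lemma up_gen2 (k l : 'I_m) : k = l.+1 :> nat \/ l = k.+1 :> nat ->
  up k (s l * s k).
Proof.
move=> kl; have km := ltn_ord k; have lm := ltn_ord l.
rewrite /up invMg !genV !actM !act_gen; case: kl => e; rewrite e in km lm *.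
  by have [l0|l0] := posnP l; eval_flip; lia.
by have [k0|k0] := posnP k; eval_flip; lia.
Qed.

Lemma up_gen3 (k l : 'I_m) : (k + l = 1)%N -> up k (s l * (s k * s l)).
Proof.
move=> kl; have km := ltn_ord k; have lm := ltn_ord l.
have [[k0 l1]|[k1 l0]] : (k = 0 :> nat /\ l = 1%N :> nat) \/ (l = 0 :> nat /\ k = 1%N :> nat) by lia.
  by rewrite /up !invMg !genV !actM !act_gen k0 l1; eval_flip; lia.
by rewrite /up !invMg !genV !actM !act_gen k1 l0; eval_flip; lia.
Qed.

(** * The regular representation of the Hecke algebra *)

Section RegularRepresentation.

Local Open Scope ring_scope.

Variables (F : fieldType) (X : F).
Hypothesis X0 : X != 0.
Local Notation N := #|W|.-1.

Lemma card_groupS : #|W| = N.+1.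
Proof. by rewrite prednK //; apply/card_gt0P; exists 1%g. Qed.

Definition elt_rank (x : W) : 'I_N.+1 := cast_ord card_groupS (enum_rank x).
Definition rank_elt (a : 'I_N.+1) : W := enum_val (cast_ord (esym card_groupS) a).

Lemma elt_rankK : cancel elt_rank rank_elt.
Proof. by move=> x; rewrite /elt_rank /rank_elt cast_ordK enum_rankK. Qed.

Lemma rank_eltK : cancel rank_elt elt_rank.
Proof. by move=> a; rewrite /elt_rank /rank_elt enum_valK cast_ordKV. Qed.

Definition basis_col (x : W) : 'cV[F]_N.+1 := delta_mx (elt_rank x) 0.

Definition mx_of (g : W -> 'cV[F]_N.+1) : 'M[F]_N.+1 :=
  \matrix_(a, b) g (rank_elt b) a 0.

Lemma mx_of_basis_col g x : mx_of g *m basis_col x = g x.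
Proof. by rewrite -colE; apply/colP => a; rewrite !mxE elt_rankK. Qed.

Lemma basis_col_ext (M M' : 'M[F]_N.+1) :
  (forall x, M *m basis_col x = M' *m basis_col x) -> M = M'.
Proof.
move=> e; apply/matrixP => a b; have := e (rank_elt b).
by rewrite /basis_col rank_eltK -!colE => /colP/(_ a); rewrite !mxE.
Qed.

Lemma basis_colE x z : basis_col x (elt_rank z) 0 = (z == x)%:R.
Proof. by rewrite mxE eqxx andbT (can_eq elt_rankK). Qed.

Lemma basis_col_sum (c : 'cV[F]_N.+1) : c = \sum_x c (elt_rank x) 0 *: basis_col x.
Proof.
have dE x a : basis_col x a 0 = (rank_elt a == x)%:R by rewrite -{1}(rank_eltK a) basis_colE.
apply/colP => a; rewrite summxE (bigD1 (rank_elt a)) //= big1 ?addr0 => [|x ne].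
  by rewrite [RHS]mxE dE eqxx mulr1 rank_eltK.
by rewrite [LHS]mxE dE eq_sym (negbTE ne) mulr0.
Qed.

(** The coefficient of T_x in H_k T_x: by the quadratic relation it vanishes when
    s_k x is longer than x and is v^-1 - v otherwise. *)
Definition slack (b : bool) : F := if b then 0 else X^-1 - X.

Definition left_mx (k : 'I_m) : 'M[F]_N.+1 :=
  mx_of (fun x => basis_col (s k * x)%g + slack (up k x) *: basis_col x).

Definition right_mx (k : 'I_m) : 'M[F]_N.+1 :=
  mx_of (fun x => basis_col (x * s k)%g + slack (up k x^-1) *: basis_col x).

Lemma left_basis_col k x :
  left_mx k *m basis_col x = basis_col (s k * x)%g + slack (up k x) *: basis_col x.
Proof. exact: mx_of_basis_col. Qed.

Lemma left_basis_col_up k x : up k x -> left_mx k *m basis_col x = basis_col (s k * x)%g.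
Proof. by move=> ux; rewrite left_basis_col ux scale0r addr0. Qed.

Lemma right_basis_col k x :
  right_mx k *m basis_col x = basis_col (x * s k)%g + slack (up k x^-1) *: basis_col x.
Proof. exact: mx_of_basis_col. Qed.

Lemma left_mx_entry k (c : 'cV[F]_N.+1) z :
  (left_mx k *m c) (elt_rank z) 0 =
  c (elt_rank (s k * z)%g) 0 + slack (up k z) * c (elt_rank z) 0.
Proof.
rewrite {1}[c]basis_col_sum mulmx_sumr summxE.
under eq_bigr => x _ do
  rewrite -scalemxAr left_basis_col mxE [X in _ * X]mxE basis_colE
    [X in _ + X]mxE basis_colE mulrDr.
rewrite big_split /=; congr (_ + _).
  rewrite (bigD1 (s k * z)%g) //= genK eqxx mulr1 big1 ?addr0 // => x xz.
  by rewrite (_ : z == _ = false) ?mulr0 //; apply: contraNF xz => /eqP ->; rewrite genK.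
rewrite (bigD1 z) //= eqxx mulr1 mulrC big1 ?addr0 // => x xz.
by rewrite eq_sym (negbTE xz) !mulr0.
Qed.

Opaque left_mx right_mx.

Lemma slackN b : slack (~~ b) = X^-1 - X - slack b.
Proof. by case: b; rewrite /slack ?subr0 ?subrr. Qed.

Lemma up_right_eq (k l : 'I_m) x : (s k * x = x * s l)%g -> up k x = up l x^-1.
Proof. by move=> e; rewrite !upE e -(ellV (s l * _)%g) invMg invgK genV ellV. Qed.

Lemma up_mull (k l : 'I_m) x : (s k * x <> x * s l)%g -> up l (s k * x)^-1 = up l x^-1.
Proof.
move=> ne; rewrite invMg genV; apply: up_mulr => e; case: ne.
by apply: invg_inj; rewrite !invMg !genV.
Qed.

(** The coefficients agree unless s_k x = x s_l; in that case both operators see the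
    same ascent. *)
Lemma left_right_comm k l : left_mx k *m right_mx l = right_mx l *m left_mx k.
Proof.
move: (left_basis_col k) (right_basis_col l) => eL eR.
move: (left_mx k) (right_mx l) eL eR => L R eL eR.
apply: basis_col_ext => x; rewrite -!mulmxA eL eR !mulmxDr -!scalemxAr !eL !eR (mulgA (s k)).
have [e|ne] := eqVneq (s k * x)%g (x * s l)%g; last first.
  rewrite (up_mulr (elimN eqP ne)) (up_mull (elimN eqP ne)) -!addrA; congr (_ + _).
  rewrite !scalerDr !scalerA addrCA; congr (_ + _); congr (_ + _).
  by rewrite mulrC.
rewrite -e up_gen {2}e.
have -> : up l (s k * x)^-1 = ~~ up l x^-1 by rewrite e invMg genV up_gen.
rewrite (up_right_eq e) slackN !scalerDr -!addrA; congr (_ + _).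
by rewrite e.
Qed.

(** The column of 1 generates all columns under the right operators. *)
Lemma right_comm_eq (M M' : 'M[F]_N.+1) :
  (forall l, M *m right_mx l = right_mx l *m M) ->
  (forall l, M' *m right_mx l = right_mx l *m M') ->
  M *m basis_col 1%g = M' *m basis_col 1%g -> M = M'.
Proof.
move=> MR MR' e1; apply: basis_col_ext => x; rewrite -(invgK x); move: {x} x^-1%g.
apply: ell_ind => [|k x ux IH]; first by rewrite invg1.
have -> : basis_col (s k * x)^-1 = right_mx k *m basis_col x^-1.
  by rewrite right_basis_col invgK ux scale0r addr0 invMg genV.
by rewrite !mulmxA MR MR' -!mulmxA IH.
Qed.

Lemma left_quadratic k :
  (left_mx k + X%:M) * (left_mx k - (X^-1)%:M) = 0.
Proof.
apply: basis_col_ext => x; rewrite mul0mx -mulmxA mulmxBl mul_scalar_mx left_basis_col.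
case ux: (up k x); rewrite /slack.
  rewrite scale0r addr0 mulmxBr -scalemxAr !mulmxDl !mul_scalar_mx (left_basis_col_up ux).
  rewrite left_basis_col up_gen ux genK /slack /= scalerBl scalerDr scalerA mulVf // scale1r.
  by rewrite addrA subrK [X in _ - X]addrC subrr.
rewrite scalerBl addrA addrAC addrK mulmxBr -scalemxAr !mulmxDl !mul_scalar_mx.
rewrite (left_basis_col k x) left_basis_col_up ?up_gen ?ux // genK /slack ?ux scalerBl !scalerDr !scalerA.
rewrite mulfV // scale1r scalerN scalerA [_ *: _ + (_ - _)]addrA subrK.
by rewrite [X in _ - X]addrC subrr.
Qed.

Lemma alternating_right k (M M' : 'M[F]_N.+1) l :
  M *m right_mx l = right_mx l *m M -> M' *m right_mx l = right_mx l *m M' ->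
  alternating k M M' *m right_mx l = right_mx l *m alternating k M M'.
Proof.
elim: k M M' => [|k IH] M M' h h' /=; first by rewrite mul1mx mulmx1.
by rewrite -!mulmxE -mulmxA IH // !mulmxA h.
Qed.

Lemma left_basis_col1 k : left_mx k *m basis_col 1%g = basis_col (s k).
Proof. by rewrite left_basis_col_up ?up1 ?mulg1. Qed.

(** Both sides commute with the right operators and send the column of 1 to the
    column of the longest element of the dihedral subgroup. *)
Lemma left_braid (k l : 'I_m) : k != l ->
  alternating (typeB_matrix k l) (left_mx k) (left_mx l) =
  alternating (typeB_matrix k l) (left_mx l) (left_mx k).
Proof.
move=> kl; apply: right_comm_eq => [r|r|]; try by apply: alternating_right; apply: left_right_comm.
have lk : l != k by rewrite eq_sym.
rewrite /typeB_matrix (negbTE kl); case: ifP => adj; last first.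
  rewrite /= !mulr1 -!mulmxA !left_basis_col1 !left_basis_col_up ?up_gen1 //.
  have [h|h] : (k.+1 < l)%N \/ (l.+1 < k)%N.
    by have : nat_of_ord k <> nat_of_ord l by [move/ord_inj/eqP; apply/negP]; lia.
  - by rewrite (gen_comm h).
  - by rewrite (gen_comm h).
have {}adj : k = l.+1 :> nat \/ l = k.+1 :> nat by case/orP: adj => /eqP; [right|left].
have adj' : l = k.+1 :> nat \/ k = l.+1 :> nat by case: adj; [right|left].
case: ifP => min0.
  have kl1 : (k + l = 1)%N by move: min0; lia.
  have lk1 : (l + k = 1)%N by rewrite addnC.
  rewrite /= !mulr1 -!mulmxA !left_basis_col1 !left_basis_col_up ?up_gen1 ?up_gen2 ?up_gen3 //.
  have [[k0 l1]|[k1 l0]] : (k = 0%N :> nat /\ l = 1%N :> nat) \/ (l = 0%N :> nat /\ k = 1%N :> nat) by lia.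
  - by rewrite !mulgA (gen_braid4 k0 l1).
  - by rewrite !mulgA (gen_braid4 k1 l0).
have k0 : (0 < k)%N by move: min0; lia.
have l0 : (0 < l)%N by move: min0; lia.
rewrite /= !mulr1 -!mulmxA !left_basis_col1 !left_basis_col_up ?up_gen1 ?up_gen2 //.
by case: adj => e; rewrite !mulgA ?(gen_braid3 l0 e) // -(gen_braid3 k0 e).
Qed.

Lemma scalar_unit : (X%:M : 'M[F]_N.+1) \is a GRing.unit.
Proof.
by apply/unitrP; exists (X^-1)%:M; rewrite -!mulmxE -!scalar_mxM mulfV // mulVf.
Qed.

Lemma scalar_inv : (X%:M : 'M[F]_N.+1)^-1 = (X^-1)%:M.
Proof.
by apply: (mulrI scalar_unit); rewrite mulrV ?scalar_unit // -mulmxE -scalar_mxM mulfV.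
Qed.

Lemma left_hecke : hecke_relations (@typeB_matrix n) (X%:M : 'M[F]_N.+1) left_mx.
Proof.
split; [exact: scalar_unit| | |exact: left_braid].
  by move=> M; rewrite /GRing.comm -!mulmxE scalar_mxC.
by move=> k; rewrite scalar_inv left_quadratic.
Qed.

End RegularRepresentation.

(** * Overlaps across one boundary *)

(** Here b1 and b2 tell whether the two neighbours r - 1 and r of the boundary come
    from the first t positions.  As s_k x is longer than x, their sources are in
    increasing order, so b2 implies b1. *)
Lemma overlap_step (k : 'I_m) c r t x : c < r < 2 * m - c -> k = letter m r :> nat -> up k x ->
  exists b1 b2 : bool, [/\ b2 -> b1,
    overlap c r.-1 t (s k * x) = overlap c r.-1 t x,
    overlap c r t x = (overlap c r.-1 t x + b1)%N,
    overlap c r t (s k * x) = (overlap c r.-1 t x + b2)%N &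
    overlap c r.+1 t x = (overlap c r.-1 t x + b1 + b2)%N /\
    overlap c r.+1 t (s k * x) = (overlap c r.-1 t x + b1 + b2)%N].
Proof.
move=> cr kr; have rm : 0 < r < 2 * m by lia.
rewrite (up_boundary _ rm kr) => lt12.
have recr y q : c <= q -> overlap c q.+1 t y = (overlap c q t y + (act y^-1 q < t))%N.
  by move=> cq; rewrite /overlap big_nat_recr.
have rS : r = r.-1.+1 by lia.
have rE : r = (m - k)%N \/ r = (m + k)%N by move: kr; rewrite /letter; lia.
have inv q : c <= q -> q <> (m - k)%N -> q <> (m + k)%N ->
    overlap c q t (s k * x) = overlap c q t x.
  by apply: overlap_gen; lia.
exists (act x^-1 r.-1 < t), (act x^-1 r < t).
have e0 : overlap c r.-1 t (s k * x) = overlap c r.-1 t x by apply: inv; lia.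
have e1 : overlap c r t x = (overlap c r.-1 t x + (act x^-1 r.-1 < t))%N.
  by rewrite {1}rS recr //; lia.
split=> //; first by move=> h; apply: ltn_trans h.
  rewrite {1}rS recr ?e0 ?act_genV; last by lia.
  by rewrite flip_up; [rewrite -rS|lia].
by rewrite inv ?recr ?e1; try lia.
Qed.

Local Open Scope ring_scope.

(** * Multiplication in the Hecke algebra *)

Variables (A : unitRingType) (v : A) (H : 'I_m -> A) (T : W -> A).
Hypotheses (hH : hecke_relations (@typeB_matrix n) v H) (hT : standard_basis s H T).
Local Notation vi := (v^-1).

Definition central (c : A) : Prop := forall a, c * a = a * c.

Lemma central_v : central v.
Proof. by move=> a; exact: (hecke_central hH). Qed.

Lemma central_vi : central vi.
Proof. by move=> a; exact/esym/commrV/esym/central_v. Qed.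

Lemma centralX c k : central c -> central (c ^+ k).
Proof. by move=> cc a; apply/esym/commrX/esym/cc. Qed.

Lemma centralM c d : central c -> central d -> central (c * d).
Proof. by move=> cc cd a; rewrite -mulrA cd !mulrA cc. Qed.

Lemma vvi : v * vi = 1. Proof. exact: (mulrV (hecke_unit hH)). Qed.
Lemma viv : vi * v = 1. Proof. exact: (mulVr (hecke_unit hH)). Qed.

Lemma quadratic k : H k * H k = 1 + (vi - v) * H k.
Proof.
have := hecke_quadratic hH k; rewrite mulrBr !mulrDl vvi => /eqP.
rewrite subr_eq0 => /eqP e.
by apply: (addIr (v * H k)); rewrite e mulNr -addrA subrK addrC central_vi.
Qed.

Lemma gen_inv k : (H k)^-1 = H k + v - vi.
Proof.
have e : H k * (H k + v - vi) = 1.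
  rewrite mulrBr mulrDr quadratic [(vi - v) * _]mulrBl -(central_v (H k)) -(central_vi (H k)).
  by rewrite addrA subrK addrK.
have e' : (H k + v - vi) * H k = 1.
  by rewrite mulrBl mulrDl quadratic [(vi - v) * _]mulrBl addrA subrK addrK.
have Hu : H k \is a GRing.unit by apply/unitrP; exists (H k + v - vi).
by apply: (mulrI Hu); rewrite mulrV.
Qed.

Lemma T1 : T 1%g = 1.
Proof.
have := hT (_ : reduced s [::]); rewrite /word_prod !big_nil => -> //.
by rewrite /reduced /word_prod big_nil ell1.
Qed.

Lemma T_up k x : up k x -> H k * T x = T (s k * x)%g.
Proof.
move=> kx; have [a sa xa] := reduced_word x.
have ra : reduced s a by rewrite /reduced -xa sa.
have rka : reduced s (k :: a) by rewrite /reduced word_cons -xa (ell_up kx) /= sa.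
by have := hT rka; rewrite word_cons -xa big_cons => ->; rewrite -(hT ra) -xa.
Qed.

Lemma T_down k x : ~~ up k x -> H k * T x = T (s k * x)%g + (vi - v) * T x.
Proof.
move=> kx; have e : H k * T (s k * x)%g = T x by rewrite T_up ?up_gen // genK.
by rewrite -{1}e mulrA quadratic mulrDl mul1r -mulrA e.
Qed.

Lemma T_up_r k x : up k x^-1 -> T x * H k = T (x * s k)%g.
Proof.
move=> kx; have [a sa xa] := reduced_word x.
have ra : reduced s a by rewrite /reduced -xa sa.
have eak : word_prod s (rcons a k) = (x * s k)%g.
  by rewrite -cats1 word_cat word_cons -xa /word_prod big_nil mulg1.
have rak : reduced s (rcons a k).
  by rewrite /reduced eak size_rcons sa -(ellV (x * s k)) invMg genV (ell_up kx) ellV.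
by have := hT rak; rewrite eak big_rcons /= => ->; rewrite -(hT ra) -xa.
Qed.

Lemma T_down_r k x : ~~ up k x^-1 -> T x * H k = T (x * s k)%g + (vi - v) * T x.
Proof.
move=> kx; have e : T (x * s k)%g * H k = T x.
  by rewrite T_up_r ?genKr // invMg genV up_gen.
rewrite -{1}e -mulrA quadratic mulrDr mulr1; congr (_ + _).
rewrite mulrA mulrBr -central_vi -central_v -mulrBl -mulrA e.
by [].
Qed.

(** The Poincare polynomial 1 + v^-2 + ... of the projective space of dimension k - 1,
    and 0 for k = 0. *)
Definition qint (k : nat) : A := \sum_(i < k) vi ^+ (2 * i).

Definition theta (f : W -> nat) : A :=
  \sum_(x : W) vi ^+ ell x * qint (f x) * T x.

Lemma qintS k : qint k.+1 = qint k + vi ^+ (2 * k).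
Proof. by rewrite /qint big_ord_recr. Qed.

Lemma central_qint k : central (qint k).
Proof.
move=> a; rewrite mulr_suml mulr_sumr; apply: eq_bigr => i _.
exact/centralX/central_vi.
Qed.

(** For b1 = b2 = 1 this is the three-term relation of quantum integers; in the other
    cases both sides have the same two terms. *)
Lemma qint_exchange a (b1 b2 : bool) : (b2 -> b1) ->
  v * qint (a + b1) + vi * qint (a + b2) = v * qint (a + b1 + b2) + vi * qint a.
Proof.
case: b2 => [/(_ isT) ->|_]; last by rewrite !addn0.
rewrite !addn1 !qintS !mulrDr -!addrA; congr (_ + (_ + _)).
rewrite addrC; congr (_ + _); rewrite mulnS -addn2 addnC exprD !expr2 mulrA.
by rewrite mulrA vvi mul1r.
Qed.

Lemma sum_pairs (sigma : W -> W) (upper : pred W) (g : W -> A) :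
  involutive sigma -> (forall x, upper (sigma x) = ~~ upper x) ->
  \sum_x g x = \sum_(x | upper x) (g x + g (sigma x)).
Proof.
move=> sK up_sigma; rewrite (bigID upper) big_split /=; congr (_ + _).
rewrite (reindex_inj (inv_inj sK)) /=; apply: eq_bigl => x.
by rewrite up_sigma negbK.
Qed.

Lemma pair_coeff (X q1 q2 t t' : A) : central X -> central q1 -> central q2 ->
  X * q1 * (t' + v * t) + X * vi * q2 * (t + vi * t') =
  X * (v * q1 + vi * q2) * t + X * vi * (v * q1 + vi * q2) * t'.
Proof.
move=> cX c1 c2; have cvi := central_vi.
have e1 : X * q1 * (v * t) = X * (v * q1) * t by rewrite (central_v q1) !mulrA.
have e2 : X * vi * q2 * (vi * t') = X * vi * (vi * q2) * t'.
  by rewrite (cvi q2) !mulrA.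
have e3 : X * vi * (v * q1) * t' = X * q1 * t' by rewrite mulrA -(mulrA X) viv mulr1.
rewrite (mulrDr (X * q1)) e1 (mulrDr (X * vi * q2)) e2 (mulrDr X) (mulrDr (X * vi)).
rewrite !mulrDl e3 -(mulrA X vi q2) [X * q1 * t' + _]addrC.
by rewrite addrACA.
Qed.

(** An operator that mixes T_x and T_(sigma x) only: on each such pair the identity
    reduces to qint_exchange.  It is stated for an abstract operator because it
    serves for multiplication on either side. *)
Lemma theta_pair (op : A -> A) (sigma : W -> W) (upper : pred W) (fm f0 fp : W -> nat) :
  (forall a b, op (a + b) = op a + op b) -> (forall c a, central c -> op (c * a) = c * op a) ->
  involutive sigma -> (forall x, upper (sigma x) = ~~ upper x) ->
  (forall x, upper x -> ell (sigma x) = (ell x).+1) ->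
  (forall x, op (T x) = T (sigma x) + (if upper x then v else vi) * T x) ->
  (forall x, upper x -> exists b1 b2 : bool, [/\ b2 -> b1,
     fm (sigma x) = fm x, f0 x = (fm x + b1)%N, f0 (sigma x) = (fm x + b2)%N &
     fp x = (fm x + b1 + b2)%N /\ fp (sigma x) = (fm x + b1 + b2)%N]) ->
  op (theta f0) = v * theta fp + vi * theta fm.
Proof.
move=> opD opZ sK up_sigma ell_sigma opT step.
have op0 : op 0 = 0 by apply: (addrI (op 0)); rewrite -opD !addr0.
rewrite /theta (big_morph op opD op0) !mulr_sumr -big_split.
rewrite !(sum_pairs _ sK up_sigma) /=; apply: eq_bigr => x ux.
have [b1 [b2 [b21 -> -> -> [-> ->]]]] := step x ux; set a := fm x.
have cX := centralX (ell x) central_vi.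
have cX' := centralX (ell x).+1 central_vi.
rewrite (ell_sigma _ ux) !opZ ?opT ?up_sigma ?ux /=; try by apply: centralM => //; apply: central_qint.
rewrite sK exprSr pair_coeff ?qint_exchange //; try exact: central_qint.
have spread X p q t : X * (v * p + vi * q) * t = v * (X * p * t) + vi * (X * q * t).
  by rewrite mulrDr mulrDl !mulrA (central_v X) (central_vi X).
by rewrite !spread.
Qed.

Lemma theta_left (k : 'I_m) c r t (phi : pred W) : (c < r < 2 * m - c)%N ->
  k = letter m r :> nat -> (forall x, phi (s k * x)%g = phi x) ->
  (H k + v) * theta (fun x => phi x * overlap c r t x)%N =
  v * theta (fun x => phi x * overlap c r.+1 t x)%N +
  vi * theta (fun x => phi x * overlap c r.-1 t x)%N.
Proof.
move=> cr kr phis; apply: (@theta_pair _ (mulg (s k)) (up k)).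
- by move=> a b; rewrite mulrDr.
- by move=> d a cd; rewrite mulrA -cd mulrA.
- by move=> x; rewrite genK.
- exact: up_gen.
- by move=> x; apply: ell_up.
- move=> x; rewrite mulrDl; case: ifP => [/T_up ->|/negbT/T_down ->] //.
  by rewrite mulrBl -addrA subrK.
move=> x ux; have [b1 [b2 [b21 e0 e1 e2 [e3 e4]]]] := overlap_step t cr kr ux.
exists (phi x && b1), (phi x && b2); rewrite phis e0 e1 e2 e3 e4.
by case: (phi x); rewrite ?mul1n ?mul0n //; split.
Qed.

Lemma theta_right (k : 'I_m) r t : (0 < r < 2 * m)%N -> k = letter m r :> nat ->
  theta (fun x => overlap 0 r t x^-1) * (H k + v) =
  v * theta (fun x => overlap 0 r.+1 t x^-1) + vi * theta (fun x => overlap 0 r.-1 t x^-1).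
Proof.
move=> rm kr.
apply: (@theta_pair (fun a => a * (H k + v)) (fun x => x * s k)%g (fun x => up k x^-1)).
- by move=> a b; rewrite mulrDl.
- by move=> d a cd; rewrite mulrA.
- by move=> x; rewrite genKr.
- by move=> x; rewrite invMg genV up_gen.
- by move=> x ux; rewrite -ellV invMg genV ell_up // ellV.
- move=> x; rewrite mulrDr -central_v; case: ifP => [/T_up_r ->|/negbT/T_down_r ->] //.
  by rewrite mulrBl -addrA subrK.
move=> x ux; have cr : (0 < r < 2 * m - 0)%N by rewrite subn0.
by have := overlap_step t cr kr ux; rewrite !invMg genV.
Qed.

(** * Bar invariance *)

Variable bar : {rmorphism A -> A}.
Hypotheses (bar_v : bar v = vi) (bar_H : forall k, bar (H k) = (H k)^-1).

Lemma bar_gen k : bar (H k + v) = H k + v.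
Proof. by rewrite rmorphD /= bar_v bar_H gen_inv subrK. Qed.

(** The bar involution turns op Z0 = v Zp + v^-1 Zm into an equation that can be solved
    for bar Zp. *)
Lemma bar_step (op : A -> A) (Zm Z0 Zp : A) e :
  (forall a, bar (op a) = op (bar a)) -> (forall c a, central c -> op (c * a) = c * op a) ->
  op Z0 = v * Zp + vi * Zm -> bar Z0 = v ^+ e * Z0 -> v ^+ 2 * bar Zm = v ^+ e * Zm ->
  bar Zp = v ^+ (e + 2) * Zp /\ v ^+ 2 * bar Z0 = v ^+ (e + 2) * Z0.
Proof.
move=> opbar opZ opZ0 b0 bm; split; last by rewrite b0 mulrA -exprD addnC.
have bar_vi : bar vi = v by rewrite rmorphV ?bar_v ?invrK // (hecke_unit hH).
have := opbar Z0; rewrite opZ0 rmorphD !rmorphM /= bar_v bar_vi b0.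
rewrite opZ; last exact/centralX/central_v.
rewrite opZ0 => /(congr1 (fun a => v * a)).
rewrite !mulrDr !mulrA vvi mul1r -expr2 bm.
have cve := centralX e central_v.
rewrite (central_v (v ^+ e)) -[X in _ = _ + X]mulrA !mulrA -(mulrA (v ^+ e) v vi) vvi mulr1.
by move/addIr ->; rewrite exprD expr2 !mulrA.
Qed.

(** As the recursion has three terms, the induction carries two consecutive values. *)
Lemma bar_chain (Z : nat -> A) (op : nat -> A -> A) c R e :
  (forall r a, bar (op r a) = op r (bar a)) ->
  (forall r d a, central d -> op r (d * a) = d * op r a) ->
  (forall r, (c < r < R)%N -> op r (Z r) = v * Z r.+1 + vi * Z r.-1) ->
  Z c = 0 -> bar (Z c.+1) = v ^+ e * Z c.+1 ->
  forall i, (c + i < R)%N -> bar (Z (c + i).+1) = v ^+ (e + 2 * i) * Z (c + i).+1.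
Proof.
move=> opbar opZ step Z0 Z1.
suff both i : (c + i < R)%N -> bar (Z (c + i).+1) = v ^+ (e + 2 * i) * Z (c + i).+1 /\
    v ^+ 2 * bar (Z (c + i)%N) = v ^+ (e + 2 * i) * Z (c + i)%N by move=> i /both [].
elim: i => [|i IH] iR; first by rewrite addn0 muln0 addn0 Z0 rmorph0 !mulr0.
have [|b0 bm] := IH; first by lia.
rewrite (_ : e + 2 * i.+1 = e + 2 * i + 2)%N; last by lia.
rewrite addnS; apply: (bar_step (opbar (c + i).+1) (opZ _) _ b0 bm).
by apply: step; lia.
Qed.

(** The pointwise stabiliser of the first c positions, the parabolic subgroup of type
    B of rank m - c. *)
Definition parabolic (c : nat) : pred W := fun x => [forall q : 'I_c, act x q == q].

Lemma parabolicP c x : reflect (forall q, (q < c)%N -> act x q = q) (parabolic c x).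
Proof.
apply: (iffP forallP) => [fx q qc|fx q]; last by apply/eqP/fx/ltn_ord.
exact: (eqP (fx (Ordinal qc))).
Qed.

Lemma parabolic_genE (k : 'I_m) c x : (c < m - k)%N -> parabolic c (s k * x)%g = parabolic c x.
Proof.
move=> ck; suff imp y : parabolic c y -> parabolic c (s k * y)%g.
  by apply/idP/idP => [/imp|/imp //]; rewrite genK.
move/parabolicP=> fy; apply/parabolicP => q qc.
by rewrite actM act_gen fy // flip_fix //; lia.
Qed.

Lemma parabolic_ge c x q : parabolic c x -> (c <= q)%N -> (c <= act x q)%N.
Proof.
move/parabolicP=> fx cq; rewrite leqNgt; apply/negP => h.
by have := fx _ h => /act_inj e; move: h; rewrite e ltnNge cq.
Qed.

Lemma parabolicV c x : parabolic c x -> parabolic c x^-1%g.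
Proof. by move/parabolicP=> fx; apply/parabolicP => q qc; rewrite -{1}(fx q qc) actK. Qed.

(** An element that fixes the first c positions sends the position c into the first
    c + 1 only if it fixes it. *)
Lemma parabolic_overlap1 c x :
  (parabolic c x * overlap c c.+1 c.+1 x)%N = parabolic c.+1 x.
Proof.
rewrite /overlap big_nat1; have [px|px] := boolP (parabolic c x); last first.
  rewrite mul0n; case: (boolP (parabolic c.+1 x)) => // /parabolicP fx.
  by case/parabolicP: px => q qc; apply: fx; apply: ltnW.
have ge := parabolic_ge (parabolicV px) (leqnn c).
rewrite mul1n ltnS; congr (nat_of_bool _); apply/idP/parabolicP => [le q|fx].
  rewrite ltnS leq_eqVlt => /orP[/eqP ->|]; last exact: (parabolicP _ _ px).
  by have e : act x^-1%g c = c by [apply/eqP; rewrite eqn_leq le]; rewrite -{1}e actKV.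
by rewrite -{1}(fx c (leqnn _)) actK.
Qed.

Lemma parabolic_overlap_full c x : (c < m)%N ->
  (parabolic c x * overlap c (2 * m - c) c.+1 x)%N = parabolic c x.
Proof.
move=> cm; have [px|px] := boolP (parabolic c x); last by rewrite mul0n.
rewrite mul1n /overlap; have ge := parabolic_ge px (leqnn c).
have lt : (act x c < 2 * m - c)%N.
  rewrite ltnNge; apply/negP => h.
  have cm2 : (c < 2 * m)%N by lia.
  have qc : (2 * m - 1 - act x c < c)%N by have := act_lt x cm2; lia.
  have := act_mirror x cm2.
  have q2 : (2 * m - 1 - c < 2 * m)%N by lia.
  move/parabolicP: px => fx; rewrite -(fx _ qc) => /act_inj.
  by have := act_lt x cm2; lia.
rewrite (bigD1_seq (act x c)) ?mem_index_iota ?ge ?lt ?iota_uniq //= actK ltnSn.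
rewrite big_nat_cond big1 ?addn0 // => q /andP[/andP[cq _] /eqP ne].
have := parabolic_ge (parabolicV px) cq; rewrite leq_eqVlt => /orP[/eqP e|]; last by lia.
by case: ne; rewrite e actKV.
Qed.

(** Inside the parabolic subgroup of rank i + 1 the overlap with the first free
    position starts as the indicator of the subgroup of rank i and ends as the
    constant 1, after 2 i + 1 steps; so the exponents are twice the squares i ^ 2,
    the lengths of the longest elements. *)
Lemma bar_parabolic i : (i <= m)%N ->
  bar (theta (parabolic (m - i)%N)) = v ^+ (2 * i ^ 2) * theta (parabolic (m - i)%N).
Proof.
elim: i => [|i IH] im.
  have -> : theta (parabolic (m - 0)%N) = 1.
    rewrite /theta (bigD1 1%g) //= big1 ?addr0 => [|x x1].
      rewrite (_ : parabolic _ _ = true) ?ell1 ?T1 ?expr0 ?mul1r ?mulr1 /qint ?big_ord1 //.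
      by apply/parabolicP => q _; rewrite act1.
    rewrite (_ : parabolic _ _ = false) ?/qint ?big_ord0 ?mulr0 ?mul0r //.
    apply/negbTE; apply: contra x1 => /parabolicP fx; apply/eqP/act_faithful => p pm.
    have [h|h] := ltnP p m; first by apply: fx; rewrite subn0.
    have q2 : (2 * m - 1 - p < 2 * m)%N by lia.
    have := act_mirror x q2; rewrite (fx (2 * m - 1 - p)%N); last by rewrite subn0; lia.
    by rewrite (_ : 2 * m - 1 - (2 * m - 1 - p) = p)%N //; lia.
  by rewrite rmorph1 mulr1.
set c := (m - i.+1)%N; have ci : (m - i = c.+1)%N by rewrite /c; lia.
pose Z r := theta (fun x => parabolic c x * overlap c r c.+1 x)%N.
have Z1 : Z c.+1 = theta (parabolic (m - i)%N).
  by rewrite ci /theta; apply: eq_bigr => x _; rewrite parabolic_overlap1.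
have Z2 : Z (2 * m - c)%N = theta (parabolic c).
  by rewrite /theta; apply: eq_bigr => x _; rewrite parabolic_overlap_full // /c; lia.
have Z0 : Z c = 0.
  rewrite /Z /theta big1 // => x _.
  by rewrite /overlap big_geq // muln0 /qint big_ord0 mulr0 mul0r.
pose op r a := (H (inord (letter m r)) + v) * a.
have chain := @bar_chain Z op c (2 * m - c)%N (2 * i ^ 2)%N.
have -> : (2 * i.+1 ^ 2 = 2 * i ^ 2 + 2 * (2 * i).+1)%N by nia.
have e : (2 * m - c = (c + (2 * i).+1).+1)%N by rewrite /c; lia.
rewrite -Z2 e; apply: chain => //; last by rewrite /c; lia.
- by move=> r a; rewrite /op rmorphM /= bar_gen.
- by move=> r d a cd; rewrite /op mulrA -cd mulrA.
- move=> r cr; have lm : (letter m r < m)%N by rewrite /letter; lia.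
  apply: theta_left; rewrite ?inordK // => x.
  by rewrite parabolic_genE // inordK // /letter; lia.
by rewrite Z1 IH // ltnW.
Qed.

(** From (1, 1) the chain first raises r by multiplication on the left, then t by
    multiplication on the right. *)
Lemma bar_overlap r t : (0 < r <= 2 * m)%N -> (0 < t <= 2 * m)%N ->
  bar (theta (overlap 0 r t)) = v ^+ (2 * (n ^ 2 + r.-1 + t.-1)) * theta (overlap 0 r t).
Proof.
move=> rm tm.
have row i : (i < 2 * m)%N ->
    bar (theta (overlap 0 i.+1 1)) = v ^+ (2 * n ^ 2 + 2 * i) * theta (overlap 0 i.+1 1).
  pose op r a := (H (inord (letter m r)) + v) * a.
  apply: (@bar_chain (fun r => theta (overlap 0 r 1)) op 0%N (2 * m)%N).
  - by move=> q a; rewrite /op rmorphM /= bar_gen.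
  - by move=> q d a cd; rewrite /op mulrA -cd mulrA.
  - move=> q qm; have lm : (letter m q < m)%N by rewrite /letter; lia.
    have := @theta_left (inord (letter m q)) 0%N q 1%N xpredT.
    rewrite subn0 inordK // => /(_ qm erefl (fun _ => erefl)).
    have E q' : theta (fun x => true * overlap 0 q' 1 x)%N = theta (overlap 0 q' 1).
      by apply: eq_bigr => x _; rewrite mul1n.
    by rewrite !E.
  - by rewrite /theta big1 // => x _; rewrite /overlap big_geq // /qint big_ord0 mulr0 mul0r.
  have := @bar_parabolic n (leqnSn n); rewrite subSnn.
  suff -> : theta (overlap 0 1 1) = theta (parabolic 1) by [].
  apply: eq_bigr => x _; rewrite -parabolic_overlap1.
  by rewrite (_ : parabolic 0 x = true) ?mul1n //; apply/parabolicP.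
have thetaV r' t' : (r' <= 2 * m)%N -> (t' <= 2 * m)%N ->
    theta (overlap 0 r' t') = theta (fun x => overlap 0 t' r' x^-1%g).
  by move=> rm' tm'; apply: eq_bigr => x _; rewrite overlapV.
pose op q a := a * (H (inord (letter m q)) + v).
have col := @bar_chain (fun q => theta (fun x => overlap 0 q r x^-1%g)) op 0%N (2 * m)%N
  (2 * (n ^ 2 + r.-1))%N.
have tE : t = (0 + t.-1).+1%N by lia.
rewrite thetaV; try lia.
rewrite (_ : 2 * (n ^ 2 + r.-1 + t.-1) = 2 * (n ^ 2 + r.-1) + 2 * t.-1)%N; last by lia.
rewrite {1 3}tE; apply: col; try lia.
- by move=> q a; rewrite /op rmorphM /= bar_gen.
- by move=> q d a cd; rewrite /op mulrA.
- by move=> q qm; apply: theta_right => //; rewrite inordK // /letter; lia.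
- by rewrite /theta big1 // => x _; rewrite /overlap big_geq // /qint big_ord0 mulr0 mul0r.
rewrite -thetaV; try lia.
have := @row r.-1; rewrite prednK; last by lia.
by rewrite mulnDr; apply; lia.
Qed.

(** * Uniqueness of bar invariant elements *)

Lemma bruhat_gt1 x : x != 1%g -> bruhat_lt s 1%g x.
Proof.
move=> x1; rewrite /bruhat_lt eq_sym x1 /=; move: {x1} x; apply: ell_ind => // k x ux IH.
apply: connect_trans IH (connect1 _); apply/existsP; exists (s k ^ x)%g.
rewrite ell_up // leqnn andbT; apply/andP; split; last by rewrite conjgE mulKVg.
by apply/existsP; exists k; apply/existsP; exists x.
Qed.

Local Notation F := {fraction {poly int}}.
Local Notation X := (tofrac ('X : {poly int})).

Lemma eval_sumX (I : Type) (r : seq I) (e : I -> nat) :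
  eval_v v (\sum_(k <- r) 'X^(e k)) = \sum_(k <- r) v ^+ e k.
Proof.
rewrite /eval_v rmorph_sum horner_sum; apply: eq_bigr => k _.
by rewrite /= map_polyXn hornerXn.
Qed.

Lemma eval_vB q1 q2 : eval_v v (q1 - q2) = eval_v v q1 - eval_v v q2.
Proof. by rewrite /eval_v rmorphB hornerD hornerN. Qed.

Section Uniqueness.

Variable f : {rmorphism A -> 'M[F]_(#|W|.-1.+1)}.
Hypotheses (f_v : f v = X%:M) (f_H : forall k, f (H k) = left_mx X k).
Local Notation basis_col := (basis_col F).

Lemma rep_T x : f (T x) *m basis_col 1%g = basis_col x.
Proof.
move: x; apply: ell_ind => [|k x ux IH]; first by rewrite T1 rmorph1 mul1mx.
by rewrite -T_up // rmorphM /= -mulmxE -mulmxA IH f_H left_basis_col_up.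
Qed.

Lemma rep_vi : f vi = (X^-1)%:M.
Proof. by rewrite rmorphV ?(hecke_unit hH) //= f_v scalar_inv // v_frac_neq0. Qed.

(** Inverting the generators in a reduced word changes T_x by terms of smaller length
    only. *)
Lemma rep_bar_T x z : (ell x <= ell z)%N ->
  (f (bar (T x)) *m basis_col 1%g) (elt_rank z) 0 = (z == x)%:R.
Proof.
move: x z; apply: ell_ind => [z _|k x ux IH z].
  by rewrite T1 !rmorph1 mul1mx basis_colE.
rewrite ell_up // => xz; rewrite -T_up // !rmorphM /= bar_H gen_inv.
rewrite rmorphB rmorphD /= f_H f_v rep_vi -mulmxE -mulmxA.
set c := _ *m basis_col _ in IH *; rewrite mulmxBl mulmxDl !mul_scalar_mx.
have cz : c (elt_rank z) 0 = 0.
  by rewrite IH ?(ltnW xz) //; case: eqP xz => // ->; rewrite ltnn.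
have scaled a : (a *: c) (elt_rank z) 0 = 0 by rewrite mxE cz mulr0.
rewrite [LHS]mxE [X in X + _]mxE left_mx_entry cz mulr0 scaled [X in _ + X]mxE scaled subr0 !addr0 IH.
  by congr (_%:R); rewrite -(inj_eq (mulgI (s k))) genK.
have [/ell_up e|/ell_down e] := boolP (up k z); last by rewrite -ltnS -e.
by rewrite e ltnW // ltnW.
Qed.

Lemma rep_eval q : f (eval_v v q) = (tofrac q)%:M.
Proof. by rewrite eval_v_rmorph f_v -(eval_v_rmorph (@scalar_mx F _)) eval_X. Qed.

Lemma rep_bar_eval q : f (bar (eval_v v q)) = (eval_v X^-1 q)%:M.
Proof. by rewrite !eval_v_rmorph bar_v rep_vi -(eval_v_rmorph (@scalar_mx F _)). Qed.

(** At an element x of maximal length with d x nonzero, rep_bar_T shows that d x itself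
    is fixed by v |-> v^-1. *)
Lemma bar_fixed_eq0 (d : W -> {poly int}) :
  (forall x, (d x)`_0 = 0) ->
  bar (\sum_x eval_v v (d x) * T x) = \sum_x eval_v v (d x) * T x ->
  forall x, d x = 0.
Proof.
move=> d0 fixed x0; apply/eqP; apply: contraT => dx0.
case: (@arg_maxnP _ x0 (fun x => d x != 0) ell dx0) => x dx max.
case/eqP: dx; apply: bar_fixed_poly_eq0 => //; rewrite eval_X.
have := congr1 (fun a => (f a *m basis_col 1%g) (elt_rank x) 0) fixed.
rewrite !rmorph_sum /= !mulmx_suml !summxE.
rewrite (bigD1 x) //= [in RHS](bigD1 x) //= !big1 ?addr0.
- rewrite !rmorphM /= -!mulmxE -!mulmxA rep_bar_eval rep_eval rep_T !mul_scalar_mx [LHS]mxE [RHS]mxE.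
  by rewrite rep_bar_T // basis_colE eqxx !mulr1.
- move=> z zx; rewrite rmorphM /= -mulmxE -mulmxA rep_eval rep_T mul_scalar_mx [LHS]mxE.
  by rewrite basis_colE eq_sym (negbTE zx) mulr0.
move=> z zx; have [z0|z0] := eqVneq (d z) 0.
  by rewrite z0 /eval_v rmorph0 horner0 mul0r !rmorph0 mul0mx mxE.
rewrite !rmorphM /= -mulmxE -mulmxA rep_bar_eval mul_scalar_mx [LHS]mxE rep_bar_T; last exact: max.
by rewrite eq_sym (negbTE zx) mulr0.
Qed.

End Uniqueness.

(** * The Kazhdan-Lusztig polynomials at the identity *)

Hypothesis hA : hecke_algebra (@typeB_matrix n) v H.
Variable p : W -> W -> {poly int}.
Hypothesis hp : kl_polynomials s v T bar p.

(** The sum of overlaps and the Kazhdan-Lusztig element of y are bar invariant, and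
    their difference has all its coefficients in v Z[v]. *)
Lemma kl_at_identity r t y : (0 < r <= 2 * m)%N -> (0 < t <= 2 * m)%N ->
  (ell y = n ^ 2 + r.-1 + t.-1)%N -> y != 1%g -> overlap 0 r t y = 1%N ->
  (forall x, x <> y -> 0 < overlap 0 r t x -> ell x + 2 * overlap 0 r t x <= (ell y).+1)%N ->
  p 1%g y = \sum_(0 <= k < minn r t) 'X^(ell y - 2 * k).
Proof.
move=> rm tm Ly y1 oy small; have [f [f_v f_H]] := hecke_univ hA (left_hecke v_frac_neq0).
pose q x : {poly int} := \sum_(k < overlap 0 r t x) 'X^(ell y - ell x - 2 * k).
pose p' x := if x == y then 1 else if bruhat_lt s x y then p x y else 0.
have [_ p0 bar_kl] := hp y.
have le x k : (k < overlap 0 r t x -> ell x + 2 * k <= ell y)%N.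
  have [->|/eqP xy] := eqVneq x y; first by rewrite oy; lia.
  by move=> kx; have := small x xy; lia.
have qE : v ^+ ell y * theta (overlap 0 r t) = \sum_x eval_v v (q x) * T x.
  rewrite mulr_sumr; apply: eq_bigr => x _; rewrite !mulrA; congr (_ * _).
  rewrite /q eval_sumX /qint mulr_sumr; apply: eq_bigr => k _.
  have lek := le x k (ltn_ord k); rewrite -mulrA -exprD.
  have -> : ell y = (ell y - ell x - 2 * k + (ell x + 2 * k))%N by lia.
  by rewrite {1}exprD -mulrA -exprMn_comm ?vvi ?expr1n ?mulr1; [congr (_ ^+ _); lia|exact: central_v].
have klE : kl_element s v T p y = \sum_x eval_v v (p' x) * T x.
  rewrite /kl_element [RHS](bigD1 y) //= /p' eqxx /eval_v rmorph1 hornerC mul1r; congr (_ + _).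
  rewrite big_mkcond [RHS]big_mkcond; apply: eq_bigr => x _ /=.
  have [->|xy] := eqVneq x y; first by rewrite /bruhat_lt eqxx.
  by case: ifP => // _; rewrite rmorph0 horner0 mul0r.
have bar_q : bar (v ^+ ell y * theta (overlap 0 r t)) = v ^+ ell y * theta (overlap 0 r t).
  rewrite rmorphM rmorphXn /= bar_v bar_overlap // -Ly mulrA; congr (_ * _).
  by rewrite mul2n -addnn exprD mulrA -exprMn_comm ?viv ?expr1n ?mul1r //; apply: central_vi.
suff : p' 1%g - q 1%g = 0.
  move/eqP; rewrite subr_eq0 /p' [1%g == y]eq_sym (negbTE y1) bruhat_gt1 // => /eqP ->.
  rewrite /q ell1 subn0 big_mkord; have -> : overlap 0 r t 1%g = minn r t; last by [].
  rewrite /overlap invg1 big_mkord.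
  under eq_bigr do rewrite act1.
  by elim: (r) => [|r' IH]; rewrite ?big_ord0 ?big_ord_recr /= ?IH; lia.
apply: (bar_fixed_eq0 f_v f_H (d := fun x => p' x - q x)).
  move=> x; rewrite coefB /p' /q; have [->|xy] := eqVneq x y.
    by rewrite oy big_ord1 subnn expr0 subrr.
  rewrite coef_sum big1 ?subr0 => [|k _].
    by case: ifP => [/p0 //|_]; rewrite coef0.
  have kx := ltn_ord k; have h := small x (elimN eqP xy).
  by rewrite coefXn (_ : _ == _ = false) //; lia.
under eq_bigr do rewrite eval_vB mulrBl.
by rewrite sumrB -qE -klE rmorphB /= bar_kl bar_q.
Qed.

Hypothesis hn : (1 <= n)%N.

Lemma unique_reduced_only (a : seq 'I_m) :
  reduced s a -> unique_reduced s (word_prod s a) -> only_word a.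
Proof.
move=> ra /cards1P[c cE] b sb eb; rewrite /reduced in ra; move/eqP: ra => ra.
have mem (b' : seq 'I_m) : size b' = ell (word_prod s a) ->
    word_prod s b' = word_prod s a -> b' = c.
  move=> sb' eb'; have : tcast sb' (in_tuple b') \in [set c].
    by rewrite -cE inE val_tcast /= eb'.
  by rewrite inE => /eqP <-; rewrite val_tcast.
have sb' : size b = ell (word_prod s a) by rewrite sb ra.
by rewrite (mem b sb' eb) -(mem a ra erefl).
Qed.

Lemma head_down k a : reduced s (k :: a) -> ~~ up k (word_prod s (k :: a)).
Proof.
move=> r; rewrite upE -leqNgt -(eqP r) word_cons genK /=.
by apply: leq_trans (ell_word a) _.
Qed.

(** The two ascents of y are the first and the last letter of the unique reduced word
    of w0 y, that is the letters at the two ends of its walk. *)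
Lemma kl_cell_identity (i j : 'I_m) y : (i, j) <> (ord0, ord0) -> y \in cell_block s i j ->
  p 1%g y = \sum_(0 <= k < (minn (n - i) (n - j)).+1) 'X^(ell y - 2 * k).
Proof.
move=> hij; rewrite inE => /andP[/imsetP[u]]; rewrite inE.
move=> /andP[u1 uniq_u] -> /andP[/eqP Ly /eqP Ry].
have [a sa ua] := reduced_word u; have ra : reduced s a by rewrite /reduced -ua sa.
have downE k z : (ell (s k * z)%g < ell z)%N = ~~ up k z.
  by have [/ell_up ->|/ell_down ->] := boolP (up k z); lia.
have left_u k : ~~ up k u -> k = i.
  move/setP: Ly => /(_ k); rewrite !inE downE up_longest negbK => ->.
  by rewrite negbK => /eqP.
have right_u k : ~~ up k u^-1 -> k = j.
  move/setP: Ry => /(_ k); rewrite !inE -ellV -(ellV (longest s * u)) !invMg genV -invMg longestV.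
  by rewrite downE up_longest negbK => ->; rewrite negbK => /eqP.
have a0 : (0 < size a)%N.
  by rewrite lt0n; apply: contra u1; rewrite ua => /eqP/size0nil ->; rewrite /word_prod big_nil.
have head_i k b : a = k :: b -> k = i.
  by move=> e; apply: left_u; rewrite ua e head_down // -e.
have last_j k b : a = rcons b k -> k = j.
  move=> e; apply: right_u; rewrite ua -word_rev e rev_rcons head_down // -rev_rcons -e.
  by rewrite /reduced size_rev word_rev ellV.
have only_a : only_word a by apply: unique_reduced_only; rewrite // -ua.
have [e|[d ad aw]] := only_word_walk hn a0 only_a.
  case: hij; case: a e head_i last_j {sa ua ra a0 only_a} => [|k [|l [|k' [|? ?]]]] //= [k0 l1 k'0] hi lj.
  rewrite -(hi _ _ erefl) -(lj k' [:: k; l]) //; congr (_, _); apply: ord_inj => /=; lia.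
have [t [t0 td dt]] : exists t, [/\ 0 < t, t <= d < 2 * m & size a = (d - t).+1]%N.
  by exists (d - size a).+1; split=> //; lia.
have iE : i = letter m d :> nat.
  case: (a) aw a0 head_i => [|k b] //= [<- _] _ hi; by rewrite (hi _ _ erefl).
have jE : j = letter m t :> nat.
  move: aw; rewrite dt walkS; case/lastP: (a) last_j => [|b k] lj.
    by case: (walk _ _ _).
  rewrite map_rcons => /rcons_inj[_ kE]; rewrite -(lj _ _ erefl) kE subKn //.
  by case/andP: td.
have tdm : (t, d) <> (m, m).
  move=> [tE dE]; case: hij; congr (_, _); apply: ord_inj.
    by rewrite iE dE /letter subnn.
  by rewrite jE tE /letter subnn.
have aw' : map val a = walk m d (d - t).+1 by rewrite -dt.
have ell_y := ell_longest u.
rewrite (@kl_at_identity (2 * m - d)%N t) //.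
- congr (\sum_(0 <= k < _) _); move: iE jE; rewrite /letter; lia.
- lia.
- lia.
- by move: ell_y; rewrite -sa dt; clear -t0 td; move: (ell _) => e; nia.
- have [k ki] : exists k : 'I_m, k != i.
    exists (if i == ord0 then ord_max else ord0).
    case: (i =P ord0) => [->|/eqP]; last by rewrite eq_sym.
    by rewrite -val_eqE /=; lia.
  apply: contraTneq ki => y1; rewrite negbK; move/setP: Ly => /(_ k).
  by rewrite !inE y1 downE up1 /= => /esym/negbFE.
- by rewrite ua; apply: overlap_top.
- by move=> x; rewrite ua; apply: overlap_small.
Qed.

End TypeB.

Local Open Scope ring_scope.

Theorem proposition5p8
  (n : nat) (hn : (1 <= n)%N)
  (W : finGroupType) (s : 'I_n.+1 -> W)
  (hW : coxeter_system s (@typeB_matrix n))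
  (A : unitRingType) (v : A) (H : 'I_n.+1 -> A)
  (hA : hecke_algebra (@typeB_matrix n) v H)
  (T : W -> A) (hT : standard_basis s H T)
  (bar : {rmorphism A -> A}) (hbar : bar_involution v H bar)
  (p : W -> W -> {poly int}) (hp : kl_polynomials s v T bar p)
  (i j : 'I_n.+1) (hij : (i, j) <> (ord0, ord0))
  (y : W) (hy : y \in cell_block s i j) :
  p 1%g y =
    \sum_(0 <= k < (minn (n - i) (n - j)).+1) 'X^(cox_length s y - 2 * k).
Proof.
have [act [act1 actM act_gen]] := action_exists hW.
have [_ bar_v bar_H] := hbar.
exact: (kl_cell_identity hW act1 actM act_gen (hecke_rel hA) hT bar_v bar_H hA hp hn hij hy).
Qed.
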